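(* Fix $\varepsilon\in(0,\tfrac12)$, $\gamma_0>0$, and set $\Gamma:=[\varepsilon,1-\varepsilon]\times[-\gamma_0,\gamma_0]$. Assume that $\underline\rho:=\inf_{\beta\in[\varepsilon,1-\varepsilon]}\min\{-\gamma(\beta),\gamma_+(\beta)\}>0$. Then there exists a finite collection $\mathcal{P}_0\subset\Pi''$ of ultimately stationary Markov policies such that for every $(\beta,\gamma)\in\Gamma$ at least one policy in $\mathcal{P}_0$ is optimal for the discounted problem (i.e. belongs to $\Pi^*(\beta,\gamma)$). More precisely, for every $\pi\in\mathcal{P}_0$ define $$K_\pi:=\{(\beta,\gamma)\in\Gamma:\ J_\gamma(x,\pi;\beta)\ge J_\gamma(x,\tilde\pi;\beta)\ \text{for every }x\in E,\ \tilde\pi\in\mathcal{P}_0\}.$$ Then: (a) every $K_\pi$ is a closed subset of $\Gamma$; (b) the sets $K_\pi$, $\pi\in\mathcal{P}_0$, cover $\Gamma$; (c) if $\pi,\sigma\in\mathcal{P}_0$ are not value-equivalent, then $K_\pi\cap K_\sigma\subset\partial_\Gamma K_\pi\cup\partial_\Gamma K_\sigma$, where $\partial_\Gamma$ denotes the relative boundary in $\Gamma$; here $\pi,\sigma\in\mathcal{P}_0$ are called value-equivalent if $J_\gamma(x,\pi;\beta)=J_\gamma(x,\sigma;\beta)$ for all $x\in E$ and $(\beta,\gamma)\in\Gamma$.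
   Context: Setting (finite discounted risk-sensitive MDP). $E=\{x_1,\dots,x_k\}$ is a finite state space and $U=\{\tilde u_1,\dots,\tilde u_l\}$ a finite action space (both nonempty); every action is available in every state. For $a\in U$, $P^a=[p_a(x_i,x_j)]_{i,j=1}^k$ is a transition probability matrix. $c\colon E\times U\to\mathbb{R}$ is a fixed running reward. $(X_n)_{n\ge 0}$ is the canonical state process. A policy is a sequence $\pi=(a_n)_{n\ge0}$, where $a_n$ is a $U$-valued function of $(X_0,\dots,X_n)$; $\Pi$ is the set of all policies. $\mathbb{E}_x^\pi$ is the expectation under the law of the process with $X_0=x$ and $\mathbb{P}(X_{n+1}=y\mid X_0,\dots,X_n)=p_{a_n}(X_n,y)$. $\Pi''\subset\Pi$ is the set of Markov policies, identified with sequences $(u_n)_{n\ge0}$, $u_n\colon E\to U$, via $a_n=u_n(X_n)$. $\Pi'\subset\Pi''$ is the set of stationary Markov policies, identified with functions $u\colon E\to U$, via $a_n=u(X_n)$ for all $n$. For $\gamma\in\mathbb{R}$, $\beta\in(0,1)$, $x\in E$, $\pi=(a_i)_{i\ge 0}\in\Pi$, put $$J_\gamma(x,\pi;\beta):=\begin{cases}\frac1\gamma\ln\mathbb{E}_x^\pi\big[e^{\gamma\sum_{i=0}^\infty\beta^i c(X_i,a_i)}\big],&\gamma\ne0,\\ \mathbb{E}_x^\pi\big[\sum_{i=0}^\infty\beta^i c(X_i,a_i)\big],&\gamma=0.\end{cases}$$ $\Pi^*(\beta,\gamma)$ is the set of Markov policies $\pi\in\Pi''$ that are optimal for every starting point,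 i.e. $J_\gamma(x,\pi;\beta)=\sup_{\pi'\in\Pi}J_\gamma(x,\pi';\beta)$ for all $x\in E$. A Markov policy $\pi\in\Pi''$ is ultimately stationary if there exist $N\in\mathbb{N}$ and functions $u_0,\dots,u_{N-1},u\colon E\to U$ such that $\pi=(u_0,\dots,u_{N-1},u,u,\dots)$. For $\beta\in(0,1)$, $$\gamma(\beta):=\inf\{r<0:\ \exists\,u\in\Pi' \text{ with } u\in\Pi^*(\beta,\gamma)\ \forall\gamma\in[r,0]\}\in[-\infty,0),$$ $$\gamma_+(\beta):=\sup\{r>0:\ \exists\,u\in\Pi' \text{ with } u\in\Pi^*(\beta,\gamma)\ \forall\gamma\in[0,r]\}\in(0,+\infty].$$ *)

(* Defs.v *)
From HB Require Import structures.
From mathcomp Require Import all_boot all_order all_algebra.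
From mathcomp Require Import all_classical all_reals all_analysis.

Set Implicit Arguments.
Unset Strict Implicit.
Unset Printing Implicit Defensive.

Import Order.TTheory GRing.Theory Num.Theory.
Import numFieldNormedType.Exports.

Local Open Scope classical_set_scope.
Local Open Scope ring_scope.

(* Nonempty finite types.  The distinguished point only witnesses nonemptiness
   (it makes the trajectory space pointed, as measurable types must be). *)
#[short(type="pointedFinType")]
HB.structure Definition PointedFinite := {T of Finite T & Pointed T}.

Record mdp (R : realType) (E U : pointedFinType) := MDP {
  trans : U -> E -> E -> R ;
  reward : E -> U -> R ;
  trans_ge0 : forall a x y, 0 <= trans a x y ;
  trans_sum1 : forall a x, \sum_y trans a x y = 1
}.

(* [policy] is the set Pi: the action at time n is a function of the n + 1
   states observed at the times 0, ..., n.  Pi'' and Pi' are embedded in it by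
   [markov] and [stationary]. *)
Definition policy (E U : Type) := forall n : nat, n.+1.-tuple E -> U.

Definition markov_policy (E U : Type) := nat -> E -> U.

Definition markov (E U : Type) (u : markov_policy E U) : policy E U :=
  fun n h => u n (tnth h ord_max).

Definition stationary (E U : Type) (u : E -> U) : markov_policy E U :=
  fun=> u.

Definition ultimately_stationary (E U : Type) (pi : markov_policy E U) :=
  exists (N : nat) (u : E -> U), forall n, (N <= n)%N -> pi n = u.

Definition coordinate_sets (E : Type) : set (set (nat -> E)) :=
  [set A | exists n y, A = [set w | w n = y]].

Definition canonical_space (E : pointedFinType) :=
  g_sigma_algebraType (@coordinate_sets E).

HB.instance Definition _ (E : pointedFinType) :=
  Measurable.on (canonical_space E).

Definition history (E : Type) (w : nat -> E) (n : nat) : n.+1.-tuple E :=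
  [tuple w (nat_of_ord i) | i < n.+1].

(* The conditional probability of moving to y given X_0, ..., X_n is written in
   product form, so that histories of probability 0 impose no constraint. *)
Definition is_law (R : realType) (E U : pointedFinType) (M : mdp R E U)
    (pi : policy E U) (x : E) (Q : probability (canonical_space E) R) :=
  Q [set w | w 0%N = x] = 1%E /\
  forall n (h : n.+1.-tuple E) y,
    Q [set w | history w n = h /\ w n.+1 = y] =
    (Q [set w | history w n = h] *
     (trans M (pi n h) (tnth h ord_max) y)%:E)%E.

(* Existence of the law: the trajectory is sampled from a uniform variable on
   [0, 1[ by splitting the interval attached to a history proportionally to the
   transition probabilities.  Histories are stored in reverse order, and
   [k s y] is the probability of y after the reversed history s. *)
Section law_existence.
Variables (R : realType) (E : pointedFinType) (k : seq E -> E -> R).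
Hypothesis k0 : forall s y, 0 <= k s y.
Hypothesis k1 : forall s, \sum_y k s y = 1.

Let F s m := \sum_(z : E | (enum_rank z < m)%N) k s z.

Fixpoint node (s : seq E) : R * R :=
  if s is y :: s' then
    ((node s').1 + (node s').2 * F s' (enum_rank y), (node s').2 * k s' y)
  else (0, 1).

Definition cell s : set R := [set` `[(node s).1, (node s).1 + (node s).2[].

Let F0 s : F s 0 = 0. Proof. by rewrite /F big_pred0. Qed.

Let FS s y : F s (enum_rank y).+1 = F s (enum_rank y) + k s y.
Proof.
rewrite /F (bigD1 y)/= ?ltnS// addrC; congr (_ + _).
apply: eq_bigl => z; rewrite ltnS (ltn_neqAle (enum_rank z)) andbC.
by rewrite (inj_eq val_inj) (inj_eq enum_rank_inj).
Qed.

Let FT s : F s #|E| = 1.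
Proof. by rewrite -(k1 s) /F; apply: eq_bigl => z; rewrite ltn_ord. Qed.

Let F_mono s m n : (m <= n)%N -> F s m <= F s n.
Proof.
move=> mn; rewrite /F [leLHS]big_mkcond [leRHS]big_mkcond/=.
apply: ler_sum => z _; case: ifPn => [zm|_]; last by case: ifPn.
by rewrite (leq_trans zm mn).
Qed.

Let node_ge0 s : 0 <= (node s).2.
Proof. by elim: s => //= y s ih; rewrite mulr_ge0. Qed.

Let cellE s r : cell s r = ((node s).1 <= r < (node s).1 + (node s).2) :> Prop.
Proof. by rewrite /cell/= in_itv. Qed.

Let cell_consE y s r : cell (y :: s) r =
  ((node s).1 + (node s).2 * F s (enum_rank y) <= r <
   (node s).1 + (node s).2 * F s (enum_rank y).+1) :> Prop.
Proof. by rewrite cellE/= FS mulrDr addrA. Qed.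

Let cell_cover s r : cell s r -> exists y, cell (y :: s) r.
Proof.
rewrite cellE => /andP[lr ru].
suff: forall m, (m <= #|E|)%N -> r < (node s).1 + (node s).2 * F s m ->
    exists y, cell (y :: s) r.
  by move/(_ #|E| (leqnn _)); apply; rewrite FT mulr1.
elim=> [_|m ih mE]; first by rewrite F0 mulr0 addr0 ltNge lr.
move=> rm; have [/ih|rm'] := ltP r ((node s).1 + (node s).2 * F s m).
  by apply; exact: ltnW.
exists (enum_val (Ordinal mE)); rewrite cell_consE enum_valK/=.
by rewrite rm' rm.
Qed.

Let cell_sub y s r : cell (y :: s) r -> cell s r.
Proof.
rewrite cell_consE cellE => /andP[a b]; apply/andP; split.
  by rewrite (le_trans _ a)// lerDl mulr_ge0// -(F0 s) F_mono.
by rewrite (lt_le_trans b)// lerD2l ler_piMr// -(FT s) F_mono.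
Qed.

Let cell_uniq y z s r : cell (y :: s) r -> cell (z :: s) r -> y = z.
Proof.
wlog yz : y z / (enum_rank y < enum_rank z)%N.
  move=> H cy cz.
  have [yz|zy|/val_inj/enum_rank_inj//] := ltngtP (enum_rank y) (enum_rank z).
    exact: H.
  by apply/esym; exact: H.
rewrite !cell_consE => /andP[_ ry] /andP[rz _]; exfalso.
have := le_lt_trans rz ry; apply/negP; rewrite -leNgt.
by rewrite lerD2l ler_wpM2l// F_mono.
Qed.

Fixpoint path_of (r : R) (n : nat) : seq E :=
  if n is n'.+1 then
    xget point [set y | cell (y :: path_of r n') r] :: path_of r n'
  else [::].

Let size_path r n : size (path_of r n) = n.
Proof. by elim: n => //= n ->. Qed.

Let cell_path r n : cell [::] r -> cell (path_of r n) r.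
Proof.
move=> r0; elim: n => //= n /cell_cover[y yr].
by case: xgetP => [_ _//|/(_ y)].
Qed.

Let path_ofP s r : cell s r -> path_of r (size s) = s.
Proof.
elim: s => //= y s ih yr; have sr := cell_sub yr; rewrite ih//; congr cons.
by case: xgetP => [z _ zr|/(_ y)//]; exact: cell_uniq zr yr.
Qed.

Let cell_root s r : cell s r -> cell [::] r.
Proof. by elim: s => // y s ih /cell_sub. Qed.

Definition sample (r : R) : canonical_space E :=
  fun n => if 0 <= r < 1 then head point (path_of r n.+1) else point.

Let cell_nil r : cell [::] r = (0 <= r < 1) :> Prop.
Proof. by rewrite cellE/= add0r. Qed.

Let sampleE r n : cell [::] r -> rev (mkseq (sample r) n) = path_of r n.
Proof.
rewrite cell_nil => r01; elim: n => // n ih.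
by rewrite mkseqS rev_rcons ih/= /sample r01.
Qed.

Let measurable_cell s : measurable (cell s).
Proof. exact: measurable_itv. Qed.

Let sample_coord n y : [set r | sample r n = y] =
  (\bigcup_(t in [set: n.-tuple E]) cell (y :: t)) `|`
  (if y == point then ~` cell [::] else set0).
Proof.
apply/seteqP; split => r /=.
  have [r01|r01] := boolP (0 <= r < 1).
    have rc : cell [::] r by rewrite cell_nil.
    rewrite /sample r01 => <-; left.
    exists (Tuple (introT eqP (size_path r n))) => //=.
    exact: (cell_path n.+1 rc).
  rewrite /sample (negbTE r01) => <-; rewrite eqxx; right => /=.
  by rewrite cell_nil; exact/negP.
case=> [[t _ yt]|].
  have := path_ofP yt => /=; rewrite size_tuple => -[yE _].
  have := cell_root yt; rewrite cell_nil => r01.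
  by rewrite /sample r01.
case: eqP => // -> /=; rewrite cell_nil => /negP r01.
by rewrite /sample (negbTE r01).
Qed.

Lemma measurable_sample :
  measurable_fun [set: measurableTypeR R] (sample : measurableTypeR R -> _).
Proof.
apply: (@measurability _ _ (measurableTypeR R) (canonical_space E) setT sample
  (@coordinate_sets E)); first by [].
move=> _ [_ [n [y ->]] <-].
rewrite setTI [X in measurable X](sample_coord n y).
apply: measurableU.
  apply: fin_bigcup_measurable; first exact: finite_finset.
  by move=> t _; exact: measurable_cell.
by case: ifP => // _; apply: measurableC; exact: measurable_cell.
Qed.

Definition sample_law : set (canonical_space E) -> \bar R :=
  pushforward (mrestr (@lebesgue_measure R) (measurable_cell [::])) sample.

Let mu01 : {measure set (measurableTypeR R) -> \bar R} :=
  mrestr (@lebesgue_measure R) (measurable_cell [::]).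

Let sample_law0 : sample_law set0 = 0%E.
Proof. by rewrite /sample_law /pushforward preimage_set0 (measure0 mu01). Qed.

Let sample_law_ge0 A : (0 <= sample_law A)%E.
Proof. exact: (measure_ge0 mu01). Qed.

Let sample_law_sigma_additive : semi_sigma_additive sample_law.
Proof.
move=> A mA tA mUA; rewrite /sample_law /pushforward preimage_bigcup.
have mS B : measurable B -> measurable (sample @^-1` B).
  by move=> mB; rewrite -[X in measurable X]setTI; exact: measurable_sample.
apply: (@measure_semi_sigma_additive _ _ _ mu01) => [n||]; first exact: mS.
- apply/trivIsetP => /= i j _ _ ij; rewrite -preimage_setI.
  by move/trivIsetP : tA => /(_ _ _ _ _ ij) ->//; rewrite preimage_set0.
- by rewrite -preimage_bigcup; exact: mS.
Qed.

#[local] HB.instance Definition _ := isMeasure.Build _ _ _ sample_law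
  sample_law0 sample_law_ge0 sample_law_sigma_additive.

Let cell_measure s : lebesgue_measure (cell s) = (node s).2%:E.
Proof.
rewrite /cell lebesgue_measure_itv/= lte_fin.
case: ifPn => [_|]; first by rewrite -EFinD addrAC subrr add0r.
by rewrite -leNgt gerDl => s0; congr EFin; apply/le_anti; rewrite s0 node_ge0.
Qed.

Let sample_law_setT : sample_law [set: _] = 1%:E.
Proof.
rewrite /sample_law /pushforward /mrestr preimage_setT setTI.
exact: cell_measure.
Qed.

#[local] HB.instance Definition _ := Measure_isProbability.Build _ _ _ sample_law
  sample_law_setT.

Lemma trajectory_law : exists Q : probability (canonical_space E) R,
  forall s, Q [set w | rev (mkseq w (size s)) = s] = (node s).2%:E.
Proof.
exists sample_law => s.
rewrite -cell_measure /sample_law /pushforward /mrestr/=.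
congr (lebesgue_measure _); apply/seteqP; split => r.
  by case=> /= + r0; rewrite sampleE// => <-; exact: cell_path.
move=> rs; have r0 := cell_root rs.
by split => //=; rewrite sampleE// path_ofP.
Qed.

End law_existence.

Lemma law_exists (R : realType) (E U : pointedFinType) (M : mdp R E U)
    (pi : policy E U) (x : E) :
  exists Q : probability (canonical_space E) R, is_law M pi x Q.
Proof.
pose k (s : seq E) y := if rev s is z :: s'
  then trans M (pi (size s') (in_tuple (z :: s'))) (last z s') y
  else (y == x)%:R.
have k0 s y : 0 <= k s y.
  by rewrite /k; case: rev => // *; exact: trans_ge0.
have k1 s : \sum_y k s y = 1.
  rewrite /k; case: rev => [|z s']; last exact: trans_sum1.
  by rewrite (bigD1 x)//= eqxx big1 ?addr0// => y /negbTE ->.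
have kE n (h : n.+1.-tuple E) y :
    k (rev h) y = trans M (pi n h) (tnth h ord_max) y.
  rewrite (tnth_nth x)/= /k revK; case: h => -[//|z s]/= sn.
  have /eqP[sE] := sn; move: sn; rewrite -sE => sn.
  rewrite (nth_last x (z :: s)); congr (trans M (pi _ _) _ _).
  exact: val_inj.
have hE n (h : n.+1.-tuple E) (w : nat -> E) :
    history w n = h <-> rev (mkseq w (size (rev h))) = rev h.
  rewrite size_rev size_tuple; split => [<-|].
    congr rev; rewrite /history/= /mkseq -val_enum_ord -map_comp.
    by rewrite enumT.
  move/(can_inj revK) => wh; apply: val_inj; rewrite /= -wh.
  by rewrite /mkseq -val_enum_ord -map_comp enumT.
have [Q QE] := trajectory_law k0 k1.
exists Q; split=> [|n h y].
  rewrite (_ : [set w | _] = [set w | rev (mkseq w (size [:: x])) = [:: x]]).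
    by rewrite QE/= mul1r /k/= eqxx.
  by apply/seteqP; split=> w; rewrite /= /mkseq /rev/=; [move=> ->|case].
rewrite (_ : [set w | history w n = h] =
    [set w | rev (mkseq w (size (rev h))) = rev h]); last first.
  by apply/seteqP; split=> w /= /hE.
rewrite (_ : [set w | _ /\ _] =
    [set w | rev (mkseq w (size (y :: rev h))) = y :: rev h]).
  by rewrite !QE/= kE EFinM.
apply/seteqP; split=> w; rewrite /= mkseqS rev_rcons size_rev size_tuple.
  by move=> [/hE + <-]; rewrite size_rev size_tuple => ->.
by move=> [-> wh]; split=> //; apply/hE; rewrite size_rev size_tuple.
Qed.

Definition law (R : realType) (E U : pointedFinType) (M : mdp R E U)
    (pi : policy E U) (x : E) : probability (canonical_space E) R :=
  sval (cid (law_exists M pi x)).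

Lemma law_is_law (R : realType) (E U : pointedFinType) (M : mdp R E U)
    (pi : policy E U) (x : E) : is_law M pi x (law M pi x).
Proof. exact: (svalP (cid (law_exists M pi x))). Qed.

Definition discounted_reward (R : realType) (E U : pointedFinType)
    (M : mdp R E U) (pi : policy E U) (beta : R) (w : canonical_space E) : R :=
  limn (series (fun i : nat => beta ^+ i * reward M (w i) (pi i (history w i)))).

Definition J (R : realType) (E U : pointedFinType) (M : mdp R E U)
    (gamma : R) (x : E) (pi : policy E U) (beta : R) : R :=
  if gamma != 0 then
    gamma^-1 *
    ln (fine 'E_(law M pi x)[fun w => expR (gamma * discounted_reward M pi beta w)])
  else fine 'E_(law M pi x)[discounted_reward M pi beta].

(* Pi^*(beta, gamma) *)
Definition optimal (R : realType) (E U : pointedFinType) (M : mdp R E U)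
    (beta gamma : R) : set (markov_policy E U) :=
  [set pi | forall x, (J M gamma x (markov pi) beta)%:E =
    ereal_sup [set (J M gamma x pi' beta)%:E | pi' in [set: policy E U]]].

(* gamma(beta) *)
Definition gamma_minus (R : realType) (E U : pointedFinType) (M : mdp R E U)
    (beta : R) : \bar R :=
  ereal_inf [set r%:E | r in [set r : R | r < 0 /\ exists u : E -> U,
    forall gamma, r <= gamma <= 0 -> optimal M beta gamma (stationary u)]].

Definition gamma_plus (R : realType) (E U : pointedFinType) (M : mdp R E U)
    (beta : R) : \bar R :=
  ereal_sup [set r%:E | r in [set r : R | 0 < r /\ exists u : E -> U,
    forall gamma, 0 <= gamma <= r -> optimal M beta gamma (stationary u)]].

Definition rho_lower (R : realType) (E U : pointedFinType) (M : mdp R E U)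
    (eps : R) : \bar R :=
  ereal_inf [set mine (- gamma_minus M beta)%E (gamma_plus M beta) |
             beta in `[eps, 1 - eps]].

(* Points are pairs (beta, gamma). *)
Definition rectangle (R : realType) (eps gamma0 : R) : set (R * R) :=
  `[eps, 1 - eps] `*` `[- gamma0, gamma0].

Definition best_in (R : realType) (E U : pointedFinType) (M : mdp R E U)
    (G : set (R * R)) (P0 : set (markov_policy E U)) (pi : markov_policy E U) :
    set (R * R) :=
  [set bg | G bg /\ forall x sigma, P0 sigma ->
    J M bg.2 x (markov sigma) bg.1 <= J M bg.2 x (markov pi) bg.1].

Definition value_equivalent (R : realType) (E U : pointedFinType)
    (M : mdp R E U) (G : set (R * R)) (pi sigma : markov_policy E U) :=
  forall x bg, G bg ->
    J M bg.2 x (markov pi) bg.1 = J M bg.2 x (markov sigma) bg.1.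

(* [subspace G] is the library's relative topology of G, extended to the whole
   type by isolated points outside G; for K included in G the two notions below
   are therefore the ones relative to G. *)
Definition rel_closed (T : topologicalType) (G K : set T) :=
  closed (K : set (subspace G)).

Definition rel_boundary (T : topologicalType) (G K : set T) : set T :=
  closure (K : set (subspace G)) `\` interior (K : set (subspace G)).

(* Main.v *)
Require Import Defs.
From mathcomp Require Import all_boot all_order all_algebra.
From mathcomp Require Import all_classical all_reals all_analysis.
From mathcomp Require Import measurable_realfun ring lra.
Import Order.TTheory GRing.Theory Num.Theory.
Import numFieldNormedType.Exports.
Set Implicit Arguments.
Unset Strict Implicit.
Unset Printing Implicit Defensive.
Local Open Scope classical_set_scope.
Local Open Scope ring_scope.

(** Write S for the discounted reward along a trajectory.  Conditioning on the
first transition gives E_x^pi[g(S)] = sum_y p(x, y) E_y^pi'[g(c + beta S)],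
where pi' is what remains of the policy pi after it has seen the state x
([Ex_one_step]).  With g = exp(gamma .) this is a Bellman equation: it expresses
J_gamma through J_(gamma beta) by a certainty equivalent, which is increasing
([J_one_step], [certainty_equivalent_le]).  Hence a Markov policy that is
optimal for (beta, gamma beta) becomes optimal for (beta, gamma) once a suitable
first decision is put in front of it ([optimal_cons]).  After n steps the risk
parameter has shrunk to gamma beta^n; for n = N large enough, uniformly on the
rectangle, it lies below the assumed lower bound rho, where some stationary
policy is optimal.  Prepending N decisions to that policy yields an optimal
policy which is constant from time N on.  There are finitely many policies of
this kind, and they form the collection P_0 ([optimal_constant_from]).

The set K_pi is closed because J is jointly continuous in (beta, gamma)
([J_continuous]).  The map X |-> ln E[e^X] is 1-Lipschitz for the uniform norm,
and S depends on beta continuously, uniformly over trajectories; at gamma = 0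
the bounds 1 + z <= e^z <= 1 + z + 2 z^2 show that J_gamma is within O(gamma) of
the mean, locally uniformly in beta.

For the boundary statement, suppose that (beta, gamma) is interior to both
K_pi and K_sigma.  Then J agrees for pi and sigma on a nondegenerate rectangle,
and equality has to be propagated to the whole strip 0 < beta < 1
([J_eq_of_rectangle]).
- In gamma: for bounded X, equality of E[e^(gamma X)] on an interval gives
  equality of all the tilted moments E[X^k e^(gamma X)] there, by differentiating,
  and the tilted moments at one gamma determine those at every other gamma by
  expanding the exponential.  So at each beta of the rectangle all the moments
  of S agree, and agreement of all the moments gives agreement of J for every
  gamma.
- In beta: a policy that is ultimately stationary has moments E_x[S^k] that are
  rational functions of beta.  Indeed the vector m_k of k-th moments of its
  stationary tail solves (1 - beta^k P) m_k = (terms in m_j, j < k), and the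
  determinant of 1 - beta^k P does not vanish for a stochastic matrix P and
  0 < beta < 1 ([moment_rational]).  Rational functions that agree on an interval
  agree everywhere.
So pi and sigma are value-equivalent. *)

(* The name [markov] also denotes an inequality on random variables. *)
Local Notation markov := Defs.markov.

(** * Bounded random variables *)

Section bounded_random_variables.
Context d (T : measurableType d) (R : realType).

(** The class of random variables used throughout: it is stable under the algebraic
operations and under continuous maps, and all its members are integrable. *)
Definition bounded_rv (X : T -> R) :=
  measurable_fun [set: T] X /\ exists B : R, forall w, `|X w| <= B.

Lemma bounded_rv_cst r : bounded_rv (cst r).
Proof. by split; [exact: measurable_cst|exists `|r|]. Qed.

Lemma bounded_rvD X Y : bounded_rv X -> bounded_rv Y -> bounded_rv (fun w => X w + Y w).
Proof.
move=> [mX [A XA]] [mY [B YB]]; split; first exact: measurable_funD.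
by exists (A + B) => w; rewrite (le_trans (ler_normD _ _))// lerD.
Qed.

Lemma bounded_rvM X Y : bounded_rv X -> bounded_rv Y -> bounded_rv (fun w => X w * Y w).
Proof.
move=> [mX [A XA]] [mY [B YB]]; split; first exact: measurable_funM.
by exists (A * B) => w; rewrite normrM ler_pM.
Qed.

Lemma bounded_rvZ r X : bounded_rv X -> bounded_rv (fun w => r * X w).
Proof. exact/bounded_rvM/bounded_rv_cst. Qed.

Lemma bounded_rvB X Y : bounded_rv X -> bounded_rv Y -> bounded_rv (fun w => X w - Y w).
Proof.
move=> bX bY; have := bounded_rvD bX (bounded_rvZ (-1) bY).
by under eq_fun do rewrite mulN1r.
Qed.

Lemma bounded_rv_sum I (r : seq I) (X : I -> T -> R) :
  (forall i, bounded_rv (X i)) -> bounded_rv (fun w => \sum_(i <- r) X i w).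
Proof.
move=> bX; elim: r => [|i r ih].
  by under eq_fun do rewrite big_nil; exact: bounded_rv_cst.
by under eq_fun do rewrite big_cons; exact: bounded_rvD.
Qed.

Lemma continuous_bounded (g : R -> R) : continuous g ->
  forall B, exists C, forall r, `|r| <= B -> `|g r| <= C.
Proof.
move=> cg B; have [B0|B0] := leP 0 B; last first.
  by exists 0 => r rB; have := le_lt_trans rB B0; rewrite normr_lt0.
have [||c _ cP] := @EVT_max R (fun r => `|g r|) (- B) B.
- by rewrite lerNl (le_trans _ B0)// oppr_le0.
- apply: continuous_subspaceT => x; apply: continuous_comp; first exact: cg.
  exact: norm_continuous.
- by exists `|g c| => r; rewrite ler_norml => rB; apply: cP; rewrite in_itv.
Qed.

Lemma bounded_rv_comp (g : R -> R) X : continuous g ->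
  bounded_rv X -> bounded_rv (fun w => g (X w)).
Proof.
move=> cg [mX [B XB]]; split.
  by apply: measurableT_comp => //; exact: continuous_measurable_fun.
by have [C gC] := continuous_bounded cg B; exists C => w; exact: gC.
Qed.

Lemma bounded_rv_expR X : bounded_rv X -> bounded_rv (fun w => expR (X w)).
Proof. by move=> bX; apply: bounded_rv_comp => //; exact: continuous_expR. Qed.

Lemma bounded_rvX k X : bounded_rv X -> bounded_rv (fun w => X w ^+ k).
Proof.
move=> bX; apply: (@bounded_rv_comp (fun r => r ^+ k)) => //.
exact: exprn_continuous.
Qed.

Variable P : probability T R.

Definition Ex (X : T -> R) : R := \int[P]_w X w.

Lemma ExE X : fine 'E_P[X] = Ex X.
Proof. by rewrite unlock. Qed.

Lemma bounded_rv_integrable X : bounded_rv X -> P.-integrable [set: T] (EFin \o X).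
Proof.
move=> [mX [B XB]]; apply: measurable_bounded_integrable => //.
  by rewrite [X in (X < _)%E]probability_setT ltry.
exists B; split; first by rewrite num_real.
by move=> M BM w _; apply: le_trans (XB w) (ltW BM).
Qed.

Lemma eq_Ex X Y : X =1 Y -> Ex X = Ex Y.
Proof. by move=> /funext ->. Qed.

Lemma Ex_cst r : Ex (fun=> r) = r.
Proof. by rewrite /Ex Rintegral_cst// [X in fine X]probability_setT mulr1. Qed.

Lemma ExD X Y : bounded_rv X -> bounded_rv Y -> Ex (fun w => X w + Y w) = Ex X + Ex Y.
Proof. by move=> bX bY; apply: RintegralD => //; exact: bounded_rv_integrable. Qed.

Lemma ExB X Y : bounded_rv X -> bounded_rv Y -> Ex (fun w => X w - Y w) = Ex X - Ex Y.
Proof. by move=> bX bY; apply: RintegralB => //; exact: bounded_rv_integrable. Qed.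

Lemma ExZ r X : bounded_rv X -> Ex (fun w => r * X w) = r * Ex X.
Proof. by move=> bX; apply: RintegralZl => //; exact: bounded_rv_integrable. Qed.

Lemma Ex_sum I (r : seq I) (X : I -> T -> R) : (forall i, bounded_rv (X i)) ->
  Ex (fun w => \sum_(i <- r) X i w) = \sum_(i <- r) Ex (X i).
Proof.
move=> bX; elim: r => [|i r ih].
  by rewrite big_nil -[RHS]Ex_cst; congr Ex; apply/funext => w; rewrite big_nil.
rewrite big_cons -ih -ExD//; last exact: bounded_rv_sum.
by congr Ex; apply/funext => w; rewrite big_cons.
Qed.

Lemma Ex_le X Y : bounded_rv X -> bounded_rv Y -> (forall w, X w <= Y w) -> Ex X <= Ex Y.
Proof.
by move=> bX bY XY; apply: le_Rintegral => //; exact: bounded_rv_integrable.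
Qed.

Lemma Ex_norm_le X B : bounded_rv X -> (forall w, `|X w| <= B) -> `|Ex X| <= B.
Proof.
move=> bX XB; have XB' w : - B <= X w <= B by rewrite -ler_norml.
rewrite ler_norml; apply/andP; split.
  by rewrite -[leLHS]Ex_cst; apply: Ex_le => // [|w]; [exact: bounded_rv_cst|case/andP: (XB' w)].
by rewrite -[leRHS]Ex_cst; apply: Ex_le => // [|w]; [exact: bounded_rv_cst|case/andP: (XB' w)].
Qed.

(** Dominated convergence with a constant as the dominating function. *)
Lemma Ex_cvg (X_ : nat -> T -> R) X B : (forall n, bounded_rv (X_ n)) ->
  (forall n w, `|X_ n w| <= B) -> (forall w, X_ ^~ w @ \oo --> X w) ->
  Ex (X_ n) @[n --> \oo] --> Ex X.
Proof.
move=> bX XB XX.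
have mX : measurable_fun [set: T] X.
  by apply: (@measurable_fun_cvg _ _ _ _ X_) => // n; have [] := bX n.
have bB : bounded_rv (cst B) by exact: bounded_rv_cst.
have bX' : bounded_rv X.
  split=> //; exists B => w.
  by apply: (cvgr_to_le (cvg_norm (XX w))); apply: nearW => n.
have [|||||_ _ cX] := @dominated_convergence _ T R P setT measurableT
  (fun n => EFin \o X_ n) (EFin \o X) (EFin \o cst B).
- by move=> n; apply/measurable_EFinP; case: (bX n).
- exact/measurable_EFinP.
- by apply: aeW => w _; apply: cvg_EFin; [exact: nearW|exact: XX].
- exact: bounded_rv_integrable.
- by apply: aeW => w n _; rewrite lee_fin.
- apply: fine_cvg; rewrite fineK; first exact: cX.
  exact: integrable_fin_num (bounded_rv_integrable bX').
Qed.

Lemma Ex_expR_gt0 X : bounded_rv X -> 0 < Ex (fun w => expR (X w)).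
Proof.
move=> bX; have [_ [B XB]] := bX.
apply: (lt_le_trans (expR_gt0 (- B))); rewrite -[leLHS]Ex_cst.
apply: Ex_le => [||w]; [exact: bounded_rv_cst|exact: bounded_rv_expR|].
by rewrite ler_expR; have := XB w; rewrite ler_norml => /andP[].
Qed.

Lemma ln_Ex_expRD X r : bounded_rv X ->
  ln (Ex (fun w => expR (X w + r))) = ln (Ex (fun w => expR (X w))) + r.
Proof.
move=> bX; under [X in Ex X]eq_fun do rewrite expRD mulrC.
rewrite ExZ; last exact: bounded_rv_expR.
by rewrite lnM ?posrE ?expR_gt0 ?Ex_expR_gt0// expRK addrC.
Qed.

Lemma ln_Ex_expR_le X Y r : bounded_rv X -> bounded_rv Y -> (forall w, X w <= Y w + r) ->
  ln (Ex (fun w => expR (X w))) <= ln (Ex (fun w => expR (Y w))) + r.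
Proof.
move=> bX bY XY; rewrite -ln_Ex_expRD// ler_ln ?posrE.
- apply: Ex_le => [||w]; [exact: bounded_rv_expR| |by rewrite ler_expR].
  by apply: bounded_rv_expR; apply: bounded_rvD => //; exact: bounded_rv_cst.
- exact: Ex_expR_gt0.
- by apply: Ex_expR_gt0; apply: bounded_rvD => //; exact: bounded_rv_cst.
Qed.

(** The map X |-> ln E[e^X] is increasing and commutes with the addition of
constants; any such map is 1-Lipschitz for the uniform norm. *)
Lemma ln_Ex_expR_dist X Y r : bounded_rv X -> bounded_rv Y -> (forall w, `|X w - Y w| <= r) ->
  `|ln (Ex (fun w => expR (X w))) - ln (Ex (fun w => expR (Y w)))| <= r.
Proof.
move=> bX bY XY; have XY' w : - r <= X w - Y w <= r by rewrite -ler_norml.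
have := @ln_Ex_expR_le X Y r bX bY; have := @ln_Ex_expR_le Y X r bY bX.
have h1 w : Y w <= X w + r by have /andP[] := XY' w; lra.
have h2 w : X w <= Y w + r by have /andP[] := XY' w; lra.
by move=> /(_ h1) + /(_ h2); rewrite ler_norml => ? ?; apply/andP; split; lra.
Qed.

(** From e^(- z) >= 1 - z one gets e^z <= 1 / (1 - z), and
(1 + z + 2 z^2) (1 - z) = 1 + z^2 (1 - 2 z) is at least 1 when z <= 1/2. *)
Lemma expR_quad (z : R) : z <= 1 / 2 -> expR z <= 1 + z + 2 * z ^+ 2.
Proof.
move=> z2; rewrite -[z in expR z]opprK expRN.
have h := expR_ge1Dx (- z).
apply: (@le_trans _ _ (1 - z)^-1).
  by rewrite lef_pV2 ?posrE ?expR_gt0//; lra.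
have z1 : 0 < 1 - z by lra.
rewrite -[leLHS]mul1r ler_pdivrMr//.
have -> : (1 + z + 2 * z ^+ 2) * (1 - z) = 1 + z ^+ 2 * (1 - 2 * z) by ring.
by rewrite lerDl mulr_ge0 ?sqr_ge0//; lra.
Qed.

(** After centering Z = X - E[X], the mean of e^(g Z) lies between 1 and
1 + 2 g^2 sup |Z|^2, because the term of first order vanishes.  The bound is
explicit because it has to be uniform in the discount factor. *)
Lemma cumulant_near0 X (B g : R) : bounded_rv X -> (forall w, `|X w| <= B) -> g != 0 ->
  `|g| * (2 * B) <= 1 / 2 ->
  `|g^-1 * ln (Ex (fun w => expR (g * X w))) - Ex X| <= `|g| * (2 * (2 * B) ^+ 2).
Proof.
move=> bX XB g0 gB; set m := Ex X; set D := 2 * B.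
have mB : `|m| <= B by exact: Ex_norm_le.
pose Z w := X w - m.
have bZ : bounded_rv Z by apply: bounded_rvB => //; exact: bounded_rv_cst.
have ZD w : `|Z w| <= D.
  by rewrite (le_trans (ler_normB _ _))// /D mulr2n mulrDl mul1r lerD.
have EZ : Ex Z = 0 by rewrite ExB// ?Ex_cst ?subrr//; exact: bounded_rv_cst.
have -> : ln (Ex (fun w => expR (g * X w))) =
    ln (Ex (fun w => expR (g * Z w))) + g * m.
  rewrite -ln_Ex_expRD; last exact: bounded_rvZ.
  by congr ln; congr Ex; apply/funext => w; congr expR; rewrite /Z; ring.
rewrite mulrDr mulKf// addrK.
have b1 : bounded_rv (fun w => 1 + g * Z w).
  by apply: bounded_rvD (bounded_rv_cst 1) (bounded_rvZ _ bZ).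
have E1 : Ex (fun w => 1 + g * Z w) = 1.
  by rewrite (ExD (bounded_rv_cst 1) (bounded_rvZ _ bZ)) Ex_cst ExZ// EZ mulr0 addr0.
have bE : bounded_rv (fun w => expR (g * Z w)) by exact/bounded_rv_expR/bounded_rvZ.
have lo : 1 <= Ex (fun w => expR (g * Z w)).
  by rewrite -[leLHS]E1; apply: Ex_le => // w; exact: expR_ge1Dx.
have hi : Ex (fun w => expR (g * Z w)) <= 1 + 2 * (g * D) ^+ 2.
  rewrite -{1}E1 -[X in _ + X]Ex_cst -(ExD b1 (bounded_rv_cst _)).
  apply: Ex_le => // [|w]; first exact: bounded_rvD b1 (bounded_rv_cst _).
  have gZ : `|g * Z w| <= `|g| * D by rewrite normrM ler_wpM2l.
  apply: (le_trans (expR_quad _)).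
    by rewrite (le_trans (ler_norm _))// (le_trans gZ).
  have sqE (r : R) : r ^+ 2 = `|r| ^+ 2 by rewrite real_normK ?num_real.
  rewrite lerD2l ler_wpM2l// [leLHS]sqE [leRHS]sqE.
  apply: lerXn2r; rewrite ?nnegrE//; apply: (le_trans gZ).
  by rewrite normrM ler_wpM2l//; exact: ler_norm.
rewrite normrM normfV ger0_norm; last exact: ln_ge0.
rewrite ler_pdivrMl ?normr_gt0//.
have t0 : 0 <= 2 * (g * D) ^+ 2 by rewrite mulr_ge0 ?sqr_ge0.
apply: (@le_trans _ _ (2 * (g * D) ^+ 2)).
  apply: le_trans (le_ln1Dx _); last by rewrite (lt_le_trans _ t0)// ltrN10.
  by rewrite ler_ln ?posrE ?(lt_le_trans _ lo) ?ltr01//; lra.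
by rewrite le_eqVlt; apply/orP; left; apply/eqP;
   rewrite exprMn -(real_normK (num_real g)); ring.
Qed.

End bounded_random_variables.

(** * Tilted moments of bounded random variables *)

Section tilted_moments.
Context d (T : measurableType d) (R : realType) (P : probability T R).
Variables (X : T -> R) (B : R).
Hypothesis bX : bounded_rv X.
Hypothesis XB : forall w, `|X w| <= B.

Definition tilted_moment k (g : R) := Ex P (fun w => X w ^+ k * expR (g * X w)).

Lemma bounded_rv_tilted k g : bounded_rv (fun w => X w ^+ k * expR (g * X w)).
Proof. by apply: bounded_rvM; [exact: bounded_rvX|exact/bounded_rv_expR/bounded_rvZ]. Qed.

Lemma tilted_bound k g w :
  `|X w ^+ k * expR (g * X w)| <= B ^+ k * expR (`|g| * B).
Proof.
rewrite normrM normrX ler_pM ?exprn_ge0// ?lerXn2r ?nnegrE//.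
  by rewrite (le_trans _ (XB w)).
rewrite ger0_norm ?expR_ge0// ler_expR (le_trans (ler_norm _))//.
by rewrite normrM ler_wpM2l.
Qed.

(** The (k+1)-st tilted moment is the derivative in g of the k-th one, with an
explicit remainder. *)
Lemma tilted_moment_diff k g h : `|h| * B <= 1 / 2 ->
  `|tilted_moment k (g + h) - tilted_moment k g - h * tilted_moment k.+1 g| <=
  h ^+ 2 * (2 * (B ^+ k.+2 * expR (`|g| * B))).
Proof.
move=> hB; rewrite /tilted_moment -ExZ; last exact: bounded_rv_tilted.
have bh := bounded_rvZ h (bounded_rv_tilted k.+1 g).
have bd := bounded_rvB (bounded_rv_tilted k (g + h)) (bounded_rv_tilted k g).
rewrite -ExB; [|exact: bounded_rv_tilted..].
rewrite -ExB//; apply: Ex_norm_le => [|w]; first exact: bounded_rvB.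
have -> : X w ^+ k * expR ((g + h) * X w) - X w ^+ k * expR (g * X w) -
    h * (X w ^+ k.+1 * expR (g * X w)) =
    X w ^+ k * expR (g * X w) * (expR (h * X w) - 1 - h * X w).
  by rewrite mulrDl expRD exprS; ring.
have hX : `|h * X w| <= 1 / 2.
  by rewrite normrM (le_trans _ hB)// ler_wpM2l.
have q : `|expR (h * X w) - 1 - h * X w| <= 2 * (h * X w) ^+ 2.
  have l := expR_ge1Dx (h * X w).
  have u := expR_quad (le_trans (ler_norm _) hX).
  by rewrite ger0_norm; lra.
rewrite normrM; have -> : h ^+ 2 * (2 * (B ^+ k.+2 * expR (`|g| * B))) =
  (B ^+ k * expR (`|g| * B)) * (2 * (h * B) ^+ 2) by rewrite !exprS; ring.
rewrite ler_pM//; first exact: tilted_bound.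
apply: (le_trans q); rewrite ler_wpM2l// !exprMn ler_wpM2l ?sqr_ge0//.
rewrite -(real_normK (num_real (X w))) lerXn2r ?nnegrE//.
by rewrite (le_trans _ (XB w)).
Qed.

Lemma exp_series_le (x : R) n : `|series (exp_coeff x) n| <= expR `|x|.
Proof.
apply: (@le_trans _ _ (series (exp_coeff `|x|) n)).
  rewrite /series/= (le_trans (ler_norm_sum _ _ _))// ler_sum// => i _.
  by rewrite /exp_coeff/= normrM normrX normfV [`|_%:R|]ger0_norm.
apply: nondecreasing_cvgn_le; last exact: is_cvg_series_exp_coeff.
by apply: nondecreasing_series => i _ _; exact: exp_coeff_ge0.
Qed.

(** Expansion of e^(t X) under the expectation: the tilted moments at one point a
give those at every a + t. *)
Lemma tilted_moment_series j a t :
  (\sum_(0 <= i < n) (i`!%:R)^-1 * t ^+ i * tilted_moment (j + i) a) @[n --> \oo] -->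
  tilted_moment j (a + t).
Proof.
pose Z n w := X w ^+ j * expR (a * X w) * series (exp_coeff (t * X w)) n.
have ZE n w : Z n w = \sum_(0 <= i < n)
    (i`!%:R)^-1 * t ^+ i * (X w ^+ (j + i) * expR (a * X w)).
  rewrite /Z /series/= mulr_sumr; apply: eq_bigr => i _.
  by rewrite /exp_coeff/= exprD exprMn; ring.
have bterm n i : bounded_rv (fun w => (i`!%:R)^-1 * t ^+ i *
    (X w ^+ (j + i) * expR (a * X w))) by exact/bounded_rvZ/bounded_rv_tilted.
have bZ n : bounded_rv (Z n).
  by rewrite (funext (ZE n)); apply: bounded_rv_sum => i; exact: bterm.
have EZ n : Ex P (Z n) =
    \sum_(0 <= i < n) (i`!%:R)^-1 * t ^+ i * tilted_moment (j + i) a.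
  rewrite (funext (ZE n)) Ex_sum; last by move=> i; exact: bterm.
  by apply: eq_bigr => i _; rewrite ExZ//; exact: bounded_rv_tilted.
under eq_cvg do rewrite -EZ.
rewrite /tilted_moment.
apply: (@Ex_cvg _ _ _ P Z _ (B ^+ j * expR (`|a| * B) * expR (`|t| * B))) => //.
  move=> n w; rewrite normrM ler_pM ?tilted_bound// (le_trans (exp_series_le _ _))//.
  by rewrite ler_expR normrM ler_wpM2l.
move=> w; rewrite mulrDl expRD mulrA; apply: cvgMl_tmp.
exact: is_cvg_series_exp_coeff.
Qed.

End tilted_moments.

Section moment_problem.
Context d (T : measurableType d) d' (T' : measurableType d') (R : realType).
Variables (P : probability T R) (Q : probability T' R).
Variables (X : T -> R) (Y : T' -> R).
Hypotheses (bX : bounded_rv X) (bY : bounded_rv Y).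
Notation mP := (tilted_moment P X).
Notation mQ := (tilted_moment Q Y).

(** Taking a = 0 this says that the moments determine the moment generating
function; taking b = 0 it recovers the moments from the tilted ones. *)
Lemma tilted_moments_determine a : (forall k, mP k a = mQ k a) ->
  forall j b, mP j b = mQ j b.
Proof.
move=> ma j b; have [_ [B XB]] := bX; have [_ [C YC]] := bY.
have cP := @tilted_moment_series _ _ _ P _ _ bX XB j a (b - a).
have cQ := @tilted_moment_series _ _ _ Q _ _ bY YC j a (b - a).
rewrite [a + _]addrC subrK in cP cQ.
have PQ : (fun n => \sum_(0 <= i < n) (i`!%:R)^-1 * (b - a) ^+ i * mP (j + i) a) =
    (fun n => \sum_(0 <= i < n) (i`!%:R)^-1 * (b - a) ^+ i * mQ (j + i) a).
  by apply/funext => n; apply: eq_bigr => i _; rewrite ma.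
by move: cP; rewrite PQ => cP; exact: (cvg_unique _ cP cQ).
Qed.

(** Induction on k: if the k-th tilted moments agree on [a, b[, so do their
derivatives, which are the next ones.  Differentiating from the right is enough
and keeps the left endpoint. *)
Lemma tilted_moments_of_interval a b : a < b ->
  (forall g, a <= g < b -> mP 0 g = mQ 0 g) ->
  forall k g, a <= g < b -> mP k g = mQ k g.
Proof.
move=> ab h0; have [_ [B0 XB0]] := bX; have [_ [C0 YC0]] := bY.
pose B := `|B0| + `|C0| + 1.
have B_gt0 : 0 < B by rewrite ltr_wpDl// addr_ge0.
have XB w : `|X w| <= B.
  by have := XB0 w; have := ler_norm B0; have := normr_ge0 C0; rewrite /B; lra.
have YB w : `|Y w| <= B.
  by have := YC0 w; have := ler_norm C0; have := normr_ge0 B0; rewrite /B; lra.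
elim=> [//|k ih] g /andP[ag gb].
apply/eqP; rewrite -subr_eq0 -normr_le0; apply/ler_addgt0Pl => e e0.
rewrite addr0.
pose K := 2 * (B ^+ k.+2 * expR (`|g| * B)).
have K0 : 0 <= K.
  by rewrite /K mulr_ge0// mulr_ge0 ?expR_ge0// exprn_ge0// ltW.
(* The increment keeps g + h inside [a, b[, satisfies the size condition of the
   expansion, and makes the two remainders together at most h * e. *)
pose h := Num.min (Num.min (1 / 2 / B) ((b - g) / 2)) (e / (2 * K + 1)).
have h0' : 0 < h.
  by rewrite !lt_min !divr_gt0 ?subr_gt0//= ltr_wpDl// mulr_ge0.
have hB : `|h| * B <= 1 / 2.
  by rewrite gtr0_norm// -ler_pdivlMr// !ge_min lexx.
have hb : h <= (b - g) / 2 by rewrite !ge_min lexx orbT.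
have he : h * (2 * K) <= e.
  apply: (@le_trans _ _ (h * (2 * K + 1))); first by rewrite ler_wpM2l ?lerDl// ltW.
  by rewrite -ler_pdivlMr ?ge_min ?lexx ?orbT// ltr_wpDl// mulr_ge0.
have := @tilted_moment_diff _ _ _ P _ _ bX XB k g _ hB.
have := @tilted_moment_diff _ _ _ Q _ _ bY YB k g _ hB.
rewrite (ih g) ?ag// (ih (g + h)); last by apply/andP; split; lra.
rewrite -/K => q p; rewrite -(ler_pM2l h0') -[h in leLHS]gtr0_norm// -normrM mulrBr.
apply: (@le_trans _ _ (h ^+ 2 * K + h ^+ 2 * K)); last first.
  by rewrite -mulrDr expr2 -mulrA ler_wpM2l ?(ltW h0')//; lra.
have -> : h * mP k.+1 g - h * mQ k.+1 g =
  (mQ k (g + h) - mQ k g - h * mQ k.+1 g) -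
  (mQ k (g + h) - mQ k g - h * mP k.+1 g) by ring.
by rewrite (le_trans (ler_normB _ _))// lerD.
Qed.

End moment_problem.

(** * Rational functions and stochastic matrices *)

Section rational_functions.
Variable R : realFieldType.
Implicit Types (f g : R -> R) (p q : {poly R}).

(** Rational functions without poles in ]0, 1[, described by the values of a
numerator and of a denominator, so that no field of fractions is involved. *)
Definition rational01 f := exists p q, forall b, 0 < b < 1 ->
  q.[b] != 0 /\ f b * q.[b] = p.[b].

Lemma rational01_poly p : rational01 (fun b => p.[b]).
Proof. by exists p, 1 => b _; rewrite hornerC oner_eq0 mulr1. Qed.

Lemma rational01_ext f g : (forall b, 0 < b < 1 -> f b = g b) ->
  rational01 f -> rational01 g.
Proof.
by move=> fg [p [q pq]]; exists p, q => b b01; rewrite -fg//; exact: pq.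
Qed.

Lemma rational01_cst r : rational01 (fun=> r).
Proof.
by apply: rational01_ext (rational01_poly r%:P) => b _; rewrite hornerC.
Qed.

Lemma rational01_exp k : rational01 (fun b => b ^+ k).
Proof.
by apply: rational01_ext (rational01_poly 'X^k) => b _; rewrite hornerXn.
Qed.

Lemma rational01D f g : rational01 f -> rational01 g ->
  rational01 (fun b => f b + g b).
Proof.
move=> [p [q pq]] [p' [q' pq']]; exists (p * q' + p' * q), (q * q') => b b01.
have [q0 pE] := pq b b01; have [q'0 p'E] := pq' b b01.
by rewrite hornerD !hornerM mulf_neq0// -pE -p'E; split=> //; ring.
Qed.

Lemma rational01M f g : rational01 f -> rational01 g ->
  rational01 (fun b => f b * g b).
Proof.
move=> [p [q pq]] [p' [q' pq']]; exists (p * p'), (q * q') => b b01.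
have [q0 pE] := pq b b01; have [q'0 p'E] := pq' b b01.
by rewrite !hornerM mulf_neq0// -pE -p'E; split=> //; ring.
Qed.

Lemma rational01_sum I (s : seq I) (f : I -> R -> R) :
  (forall i, rational01 (f i)) -> rational01 (fun b => \sum_(i <- s) f i b).
Proof.
move=> rf; elim: s => [|i s ih].
  by apply: rational01_ext (rational01_cst 0) => b _; rewrite big_nil.
by apply: rational01_ext (rational01D (rf i) ih) => b _; rewrite big_cons.
Qed.

Lemma rational01_div p f g : (forall b, 0 < b < 1 -> p.[b] != 0) ->
  (forall b, 0 < b < 1 -> p.[b] * f b = g b) -> rational01 g -> rational01 f.
Proof.
move=> p0 pfg [p' [q' pq']]; exists p', (p * q') => b b01.
have [q'0 p'E] := pq' b b01; rewrite hornerM mulf_neq0// ?p0//; split=> //.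
by rewrite -p'E -pfg//; ring.
Qed.

(** The points a + (b - a) / (i + 1) are as many distinct roots as needed. *)
Lemma poly_interval_eq0 p (a b : R) : a < b ->
  (forall x, a <= x <= b -> p.[x] = 0) -> p = 0.
Proof.
move=> ab px; apply/eqP; apply: contraT => p0.
pose rs := [seq a + (b - a) / i.+1%:R | i <- iota 0 (size p)].
have := max_poly_roots p0 (rs := rs); rewrite size_map size_iota ltnn.
apply.
  apply/allP => _ /mapP[i _ ->]; apply/eqP/px; rewrite lerDl divr_ge0 ?subr_ge0 ?(ltW ab)//=.
  by rewrite -lerBrDl ler_pdivrMr ?ltr0n// ler_peMr ?subr_ge0 ?(ltW ab)// ler1n.
rewrite map_inj_uniq ?iota_uniq// => i j /addrI /mulfI ij.
have /ij/invr_inj/eqP : b - a != 0 by rewrite subr_eq0 gt_eqF.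
by rewrite eqr_nat => /eqP[].
Qed.

Lemma rational01_identity f g (a b : R) : rational01 f -> rational01 g ->
  a < b -> (forall x, a <= x <= b -> 0 < x < 1) ->
  (forall x, a <= x <= b -> f x = g x) ->
  forall x, 0 < x < 1 -> f x = g x.
Proof.
move=> [p [q pq]] [p' [q' pq']] ab ab01 fg x x01.
have : p * q' - p' * q = 0.
  apply: (poly_interval_eq0 ab) => y yab; have y01 := ab01 _ yab.
  have [_ pE] := pq y y01; have [_ p'E] := pq' y y01.
  by rewrite hornerD hornerN !hornerM -pE -p'E fg//; ring.
move/(congr1 (horner^~ x)); rewrite hornerD hornerN !hornerM horner0.
have [q0 <-] := pq x x01; have [q'0 <-] := pq' x x01 => /eqP.
rewrite subr_eq0 mulrAC [eqbRHS]mulrAC -!mulrA [q.[x] * _]mulrC => /eqP.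
by apply: mulIf; rewrite mulf_neq0.
Qed.

End rational_functions.

Section stochastic_resolvent.
Variables (R : realFieldType) (E : finType) (P : E -> E -> R).
Hypothesis P0 : forall x y, 0 <= P x y.
Hypothesis P1 : forall x, \sum_y P x y = 1.

Let n := #|E|.

(** The matrix 1 - r P. *)
Definition resolvent_mx (r : R) : 'M[R]_n :=
  \matrix_(i, j) ((i == j)%:R - r * P (enum_val i) (enum_val j)).

(** A row vector v with v = r v P satisfies |v|_1 <= r |v|_1, hence vanishes. *)
Lemma resolvent_det_neq0 (r : R) : 0 <= r < 1 -> \det (resolvent_mx r) != 0.
Proof.
move=> /andP[r0 r1]; apply/det0P => -[v v0 /matrixP vA].
have vE j : v 0 j = r * \sum_i v 0 i * P (enum_val i) (enum_val j).
  have := vA 0 j; rewrite !mxE; under eq_bigr do rewrite mxE mulrBr.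
  rewrite sumrB (bigD1 j)//= eqxx mulr1 big1 ?addr0; last first.
    by move=> i /negbTE ->; rewrite mulr0.
  by move=> /eqP; rewrite subr_eq0 => /eqP ->; rewrite mulr_sumr; apply: eq_bigr => i _; ring.
pose s := \sum_j `|v 0 j|.
have sle : s <= r * s.
  rewrite {1}/s; under eq_bigr do rewrite vE normrM ger0_norm//.
  rewrite -mulr_sumr ler_wpM2l//.
  apply: (@le_trans _ _ (\sum_j \sum_i `|v 0 i| * P (enum_val i) (enum_val j))).
    apply: ler_sum => j _; rewrite (le_trans (ler_norm_sum _ _ _))//.
    by apply: ler_sum => i _; rewrite normrM [`|P _ _|]ger0_norm.
  rewrite exchange_big/=; apply: ler_sum => i _; rewrite -mulr_sumr.
  by rewrite -[leRHS]mulr1 -(P1 (enum_val i)) [in leRHS](reindex_onto enum_val enum_rank)/=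
    => [|? _]; rewrite ?enum_rankK//; under [in leRHS]eq_bigl do rewrite enum_valK eqxx.
have : s = 0.
  by apply/eqP; rewrite eq_le [0 <= s]sumr_ge0 ?andbT//; nra.
move/eqP; rewrite psumr_eq0// => /allP vj; move/negP: v0; apply.
apply/eqP/rowP => j; rewrite mxE; apply/eqP; rewrite -normr_eq0.
by apply: vj; rewrite mem_index_enum.
Qed.

(** Cramer's rule: the determinant and the adjugate of 1 - t^k P are polynomial in t,
and the determinant has no zero in ]0, 1[. *)
Lemma resolvent_rational k (v b : E -> R -> R) : (0 < k)%N ->
  (forall x, rational01 (b x)) ->
  (forall x t, 0 < t < 1 -> v x t = t ^+ k * \sum_y P x y * v y t + b x t) ->
  forall x, rational01 (v x).
Proof.
move=> k0 rb vE x.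
pose A : 'M[{poly R}]_n :=
  \matrix_(i, j) ((i == j)%:R - 'X^k * (P (enum_val i) (enum_val j))%:P).
have AE t : map_mx (horner_eval t) A = resolvent_mx (t ^+ k).
  apply/matrixP => i j; rewrite !mxE /horner_eval hornerD hornerN hornerM.
  by rewrite hornerXn hornerC; case: eqP; rewrite ?hornerC.
apply: (@rational01_div _ (\det A) _
  (fun t => \sum_j (\adj A (enum_rank x) j).[t] * b (enum_val j) t)).
- move=> t t01; rewrite -[_.[t]]/(horner_eval t (\det A)) -det_map_mx AE.
  apply: resolvent_det_neq0; have /andP[t0 t1] := t01.
  by rewrite exprn_ge0 ?ltW//= exprn_ilt1 ?ltW// -lt0n.
- move=> t t01; pose V := \col_(j < n) v (enum_val j) t.
  have AV : map_mx (horner_eval t) A *m V = \col_(j < n) b (enum_val j) t.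
    rewrite AE; apply/colP => i; rewrite !mxE.
    under eq_bigr do rewrite !mxE mulrBl.
    rewrite sumrB (bigD1 i)//= eqxx mul1r big1 ?addr0; last first.
      by move=> j; rewrite eq_sym => /negbTE ->; rewrite mul0r.
    rewrite vE// mulr_sumr (reindex_onto enum_val enum_rank)/=; last first.
      by move=> ? _; rewrite enum_rankK.
    under eq_bigl do rewrite enum_valK eqxx.
    by under [X in _ - X]eq_bigr do rewrite -mulrA; rewrite addrAC subrr add0r.
  have := congr1 (mulmx (\adj (map_mx (horner_eval t) A))) AV.
  rewrite mulmxA mul_adj_mx det_map_mx mul_scalar_mx -map_mx_adj.
  move/colP/(_ (enum_rank x)); rewrite !mxE enum_rankK /horner_eval => ->.
  by apply: eq_bigr => j _; rewrite !mxE.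
- apply: rational01_sum => j; apply: rational01M => //; exact: rational01_poly.
Qed.

End stochastic_resolvent.

(** * Trajectories and conditioning on the first transition *)

Section trajectories.
Context (E : pointedFinType).
Implicit Types (w : canonical_space E) (s : seq E).

(** The event that the trajectory starts with the word s; in terms of words the
time index disappears from the bookkeeping of histories. *)
Definition cylinder s : set (canonical_space E) :=
  [set w | mkseq w (size s) = s].

Definition path_cons (x : E) w : canonical_space E :=
  fun n => if n is m.+1 then w m else x.

Lemma mkseq_path_cons x w n : mkseq (path_cons x w) n.+1 = x :: mkseq w n.
Proof.
by rewrite /mkseq /= -[1%N]/(1 + 0)%N iotaDl -map_comp.
Qed.

Lemma val_history w n : history w n = mkseq w n.+1 :> seq E.
Proof. by rewrite /history/= /mkseq -val_enum_ord -map_comp enumT. Qed.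

Lemma historyE n (h : n.+1.-tuple E) :
  [set w | history w n = h] = cylinder h.
Proof.
apply/seteqP; split=> w' /=; rewrite /cylinder/= size_tuple -val_history.
  by move=> ->.
exact: val_inj.
Qed.

Lemma history_path_cons x w n :
  history (path_cons x w) n.+1 = [tuple of x :: history w n].
Proof. by apply: val_inj; rewrite /= val_history mkseq_path_cons val_history. Qed.

Lemma cylinder_rcons s y :
  cylinder (rcons s y) = cylinder s `&` [set w | w (size s) = y].
Proof.
apply/seteqP; split=> w; rewrite /cylinder/= size_rcons mkseqS.
  by move=> /rcons_inj[].
by move=> [-> ->].
Qed.

Lemma measurable_cylinder s : measurable (cylinder s).
Proof.
elim/last_ind: s => [|s y ih].
  rewrite (_ : cylinder _ = setT); first exact: measurableT.
  by apply/seteqP; split.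
rewrite cylinder_rcons; apply: measurableI => //.
by apply: sub_sigma_algebra; exists (size s), y.
Qed.

Definition depends_on_prefix (T : Type) n (f : canonical_space E -> T) :=
  forall w w', mkseq w n = mkseq w' n -> f w = f w'.

(** The word h is extended by a default state: f does not see the values beyond n. *)
Lemma prefix_decomposition (R : realType) n (f : canonical_space E -> R) :
  depends_on_prefix n f ->
  f = fun w => \sum_(h : n.-tuple E) f (nth point h) * \1_(cylinder h) w.
Proof.
move=> fn; apply/funext => w.
have sz : size (mkseq w n) == n by rewrite size_mkseq.
rewrite (bigD1 (Tuple sz))//= big1 ?addr0 => [|h hw].
  rewrite indicE mem_set ?mulr1; last by rewrite /cylinder/= size_mkseq.
  apply: fn; apply: (@eq_from_nth _ point); rewrite !size_mkseq// => i iN.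
  by rewrite !nth_mkseq.
rewrite indicE memNset ?mulr0//; rewrite /cylinder/= size_tuple => wh.
by move/eqP: hw; apply; apply: val_inj.
Qed.

Lemma prefix_bounded_rv (R : realType) n (f : canonical_space E -> R) :
  depends_on_prefix n f -> bounded_rv f.
Proof.
move=> /prefix_decomposition ->; apply: bounded_rv_sum => h; apply: bounded_rvZ.
split; first by apply: measurable_indic; exact: measurable_cylinder.
by exists 1 => w; rewrite indicE; case: (_ \in _); rewrite ?normr1 ?normr0.
Qed.

End trajectories.

Lemma big_tuple_cons (V : nmodType) (E : finType) n (F : n.+1.-tuple E -> V) :
  \sum_h F h = \sum_x \sum_(t : n.-tuple E) F [tuple of x :: t].
Proof.
rewrite pair_big/=; apply: (reindex (fun p : E * n.-tuple E => [tuple of p.1 :: p.2])).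
exists (fun h : n.+1.-tuple E => (thead h, [tuple of behead h])) => [[x t] _|h _] /=.
  by rewrite theadE; congr (_, _); apply: val_inj.
by rewrite [RHS]tuple_eta.
Qed.

Section one_step.
Context (R : realType) (E U : pointedFinType) (M : mdp R E U).
Implicit Types (pi : policy E U) (x y z : E) (w : canonical_space E).

(** The policy that remains after a first visit to x: it acts as pi does on the
history with x put in front. *)
Definition tail_policy pi x : policy E U :=
  fun n h => pi n.+1 [tuple of x :: h].

Definition first_action pi x : U := pi 0 [tuple x].

Definition cylinder_prob pi x s : R := fine (law M pi x (cylinder s)).

Lemma cylinder_prob1 pi x z : cylinder_prob pi x [:: z] = (z == x)%:R.
Proof.
have [Q1 _] := law_is_law M pi x.
have cE y : cylinder [:: y] = [set w | w 0%N = y].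
  by apply/seteqP; split=> w; rewrite /cylinder/= /mkseq/=; [case|move=> ->].
rewrite /cylinder_prob; have [->|zx] := eqVneq z x; first by rewrite cE Q1.
have : (law M pi x (cylinder [:: z]) <= law M pi x (~` cylinder [:: x]))%E.
  apply: le_measure; rewrite ?inE.
  - exact: measurable_cylinder.
  - by apply: measurableC; exact: measurable_cylinder.
  - by rewrite !cE => w /= -> /eqP; rewrite (negbTE zx).
rewrite probability_setC; last exact: measurable_cylinder.
rewrite (cE x) Q1 subee// => h.
by have -> : law M pi x (cylinder [:: z]) = 0%E
  by apply/eqP; rewrite eq_le h/= measure_ge0.
Qed.

Lemma cylinder_prob_rcons pi x n (h : n.+1.-tuple E) y :
  cylinder_prob pi x (rcons h y) =
  cylinder_prob pi x h * trans M (pi n h) (tnth h ord_max) y.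
Proof.
have [_ /(_ n h y)] := law_is_law M pi x.
rewrite historyE => hy; rewrite /cylinder_prob.
have -> : cylinder (rcons h y) = [set w | history w n = h /\ w n.+1 = y].
  by rewrite cylinder_rcons size_tuple -historyE.
by rewrite hy fineM//; apply: fin_num_measure; exact: measurable_cylinder.
Qed.

(** The law is specified by appending a state to a history; this is the same
specification read from the front, obtained by induction on the appended
states. *)
Lemma cylinder_prob_cons pi x z n (t : n.+1.-tuple E) :
  cylinder_prob pi x (z :: t) =
  (z == x)%:R * \sum_y trans M (first_action pi x) x y *
                       cylinder_prob (tail_policy pi x) y t.
Proof.
elim: n t => [|n ih] t.
  have [y0 ->] : exists y0, t = [tuple y0].
    by case: t => -[//|y0 [|//]] sz; exists y0; apply: val_inj.
  have := cylinder_prob_rcons pi x [tuple z] y0; rewrite /= => ->.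
  rewrite cylinder_prob1 (tnth_nth z)/=; have [->|] := eqVneq z x; last by rewrite !mul0r.
  congr (_ * _); rewrite (bigD1 y0)//= cylinder_prob1 (eqxx y0) mulr1 big1 ?addr0//.
  by move=> y /negbTE yt; rewrite cylinder_prob1 eq_sym yt mulr0.
have [t' [y ->]] : exists (t' : n.+1.-tuple E) y, t = [tuple of rcons t' y].
  case: t => s sz; case/lastP: s sz => // s y sz.
  have sz' : size s == n.+1 by move: sz; rewrite size_rcons.
  by exists (Tuple sz'), y; apply: val_inj.
have := cylinder_prob_rcons pi x [tuple of z :: t'] y; rewrite /= => ->.
rewrite ih -mulrA mulr_suml; have [->|] := eqVneq z x; last by rewrite !mul0r.
congr (_ * _); apply: eq_bigr => y' _; rewrite cylinder_prob_rcons -mulrA.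
congr (_ * (_ * _)); rewrite /tail_policy; congr (trans M (pi _ _) _ _).
by rewrite !(tnth_nth y)/= .
Qed.

Lemma Ex_prefix pi x n (f : canonical_space E -> R) : depends_on_prefix n f ->
  Ex (law M pi x) f = \sum_(h : n.-tuple E) f (nth point h) * cylinder_prob pi x h.
Proof.
move=> fn; rewrite {1}(prefix_decomposition fn).
have bI (h : n.-tuple E) : bounded_rv (\1_(cylinder h) : canonical_space E -> R).
  apply: (@prefix_bounded_rv _ _ n) => w w' ww'; rewrite !indicE.
  congr ((nat_of_bool _)%:R).
  by apply/idP/idP; rewrite !inE /cylinder/= size_tuple ww'.
rewrite Ex_sum; last by move=> h; exact/bounded_rvZ.
apply: eq_bigr => h _; rewrite ExZ//; congr (_ * _).
rewrite /Ex /Rintegral integral_indic ?setIT//; exact: measurable_cylinder.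
Qed.

Lemma Ex_prefix_one_step pi x n (f : canonical_space E -> R) :
  depends_on_prefix n.+2 f ->
  Ex (law M pi x) f = \sum_y trans M (first_action pi x) x y *
    Ex (law M (tail_policy pi x) y) (f \o path_cons x).
Proof.
move=> fn; have fxn : depends_on_prefix n.+1 (f \o path_cons x).
  by move=> w w' ww'; apply: fn; rewrite !mkseq_path_cons ww'.
rewrite (Ex_prefix _ _ fn) big_tuple_cons (bigD1 x)//= [X in _ + X]big1 ?addr0; last first.
  move=> z /negbTE zx; rewrite big1// => t _.
  by rewrite cylinder_prob_cons zx mul0r mulr0.
under [RHS]eq_bigr do rewrite (Ex_prefix _ _ fxn) mulr_sumr.
rewrite exchange_big/=; apply: eq_bigr => t _.
rewrite cylinder_prob_cons eqxx mul1r mulr_sumr; apply: eq_bigr => y _.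
rewrite mulrCA; congr (_ * (f _ * _)).
by apply/funext => -[].
Qed.

Definition reward_bound : R := \sum_x \sum_a `|reward M x a|.

Lemma reward_boundP x a : `|reward M x a| <= reward_bound.
Proof.
rewrite /reward_bound (bigD1 x)//= (bigD1 a)//= -addrA lerDl addr_ge0//.
  by rewrite sumr_ge0.
by rewrite sumr_ge0// => y _; rewrite sumr_ge0.
Qed.

Lemma reward_bound_ge0 : 0 <= reward_bound.
Proof. by rewrite sumr_ge0// => x _; rewrite sumr_ge0. Qed.

Definition partial_reward pi (b : R) n w : R :=
  series (fun i => b ^+ i * reward M (w i) (pi i (history w i))) n.

Lemma partial_reward_prefix pi b n : depends_on_prefix n (partial_reward pi b n).
Proof.
move=> w w' ww'; rewrite /partial_reward /series/= !big_mkord.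
apply: eq_bigr => i _.
have nE j : (j < n)%N -> w j = w' j.
  by move=> jn; have := congr1 (nth point ^~ j) ww'; rewrite !nth_mkseq.
rewrite nE//; congr (_ * reward M _ (pi _ _)).
apply: val_inj; rewrite /= !val_history; apply/eq_in_map => j.
by rewrite mem_iota add0n ltnS => /andP[_ ji]; rewrite nE// (leq_ltn_trans ji).
Qed.

Lemma partial_reward_path_cons pi b n x w :
  partial_reward pi b n.+1 (path_cons x w) =
  reward M x (first_action pi x) + b * partial_reward (tail_policy pi x) b n w.
Proof.
rewrite /partial_reward /series/= big_nat_recl// expr0 mul1r mulr_sumr.
congr (_ + _).
  by congr (reward M _ (pi _ _)); apply: val_inj; rewrite /= val_history.
apply: eq_bigr => i _; rewrite exprS mulrA history_path_cons//.
Qed.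

Variables (b : R).
Hypothesis b01 : 0 < b < 1.

Let b_norm : `|b| < 1.
Proof. by have /andP[b0 b1] := b01; rewrite gtr0_norm. Qed.

Lemma discounted_term_le pi w i :
  `|b ^+ i * reward M (w i) (pi i (history w i))| <= geometric reward_bound b i.
Proof.
have /andP[b0 _] := b01.
rewrite normrM ger0_norm ?exprn_ge0 ?(ltW b0)// /geometric/= mulrC.
by rewrite ler_wpM2r ?reward_boundP// exprn_ge0// ltW.
Qed.

Lemma geometric_partial_le (C : R) n : 0 <= C -> series (geometric C b) n <= C / (1 - b).
Proof.
have /andP[b0 b1] := b01; move=> C0.
have cv := @cvg_geometric_series R C b b_norm.
rewrite -(cvg_lim _ cv)//; apply: nondecreasing_cvgn_le; last by apply/cvg_ex; eexists; exact: cv.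
by apply: nondecreasing_series => i _ _; rewrite /geometric/= mulr_ge0// exprn_ge0// ltW.
Qed.

(** A bound for the discounted reward, uniform over policies and trajectories. *)
Definition horizon_bound := reward_bound / (1 - b).

Lemma partial_reward_le pi n w : `|partial_reward pi b n w| <= horizon_bound.
Proof.
rewrite /partial_reward /series/= (le_trans (ler_norm_sum _ _ _))//.
apply: (@le_trans _ _ (series (geometric reward_bound b) n)).
  by apply: ler_sum => i _; exact: discounted_term_le.
exact/geometric_partial_le/reward_bound_ge0.
Qed.

Lemma partial_reward_cvg pi w :
  partial_reward pi b ^~ w @ \oo --> discounted_reward M pi b w.
Proof.
have cv : cvgn (series (fun i => b ^+ i * reward M (w i) (pi i (history w i)))).
  apply: normed_cvg; apply: (@series_le_cvg _ _ (geometric reward_bound b)).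
  - by move=> n; rewrite normr_ge0.
  - move=> n; rewrite /geometric/= mulr_ge0 ?reward_bound_ge0// exprn_ge0// ltW//.
    by case/andP: b01.
  - by move=> n; exact: discounted_term_le.
  - exact: is_cvg_geometric_series.
exact: cv.
Qed.

Arguments partial_reward_cvg pi w : clear implicits.

Lemma discounted_reward_le pi w : `|discounted_reward M pi b w| <= horizon_bound.
Proof.
apply: (cvgr_to_le (cvg_norm (partial_reward_cvg pi w))).
by apply: nearW => n; exact: partial_reward_le.
Qed.

Lemma bounded_rv_partial_reward pi n : bounded_rv (partial_reward pi b n).
Proof. exact: (prefix_bounded_rv (@partial_reward_prefix pi b n)). Qed.

Lemma bounded_rv_discounted_reward pi : bounded_rv (discounted_reward M pi b).
Proof.
split; last by exists horizon_bound => w; exact: discounted_reward_le.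
apply: (@measurable_fun_cvg _ _ _ _ (partial_reward pi b)) => [n|w _].
  by have [] := bounded_rv_partial_reward pi n.
exact: partial_reward_cvg.
Qed.

Lemma Ex_partial_cvg pi x (g : R -> R) : continuous g ->
  Ex (law M pi x) (fun w => g (partial_reward pi b n w)) @[n --> \oo] -->
  Ex (law M pi x) (fun w => g (discounted_reward M pi b w)).
Proof.
move=> cg; have [C gC] := continuous_bounded cg horizon_bound.
apply: (@Ex_cvg _ _ _ _ _ _ C) => [n|n w|w].
- exact: bounded_rv_comp cg (bounded_rv_partial_reward pi n).
- exact/gC/partial_reward_le.
- by apply: cvg_comp (partial_reward_cvg pi w) _; exact: cg.
Qed.

(** The Markov property at time 1, in the only form that is used.  For partial sums
it is a finite computation on cylinders; the general case is a limit of these. *)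
Lemma Ex_one_step pi x (g : R -> R) : continuous g ->
  Ex (law M pi x) (fun w => g (discounted_reward M pi b w)) =
  \sum_y trans M (first_action pi x) x y *
    Ex (law M (tail_policy pi x) y) (fun w =>
      g (reward M x (first_action pi x) +
         b * discounted_reward M (tail_policy pi x) b w)).
Proof.
move=> cg; set r := reward M x _.
have cg' : continuous (fun s => g (r + b * s)).
  move=> s; apply: continuous_comp; last exact: cg.
  by apply: cvgD; [exact: cvg_cst|apply: cvgM; [exact: cvg_cst|exact: cvg_id]].
(* n + 2 rewards before and n + 1 rewards after the first transition: a first
   transition has to be there in order to be split off. *)
have c1 := @Ex_partial_cvg pi x g cg.
rewrite -(cvg_shiftn 2) in c1.
have c2 : \sum_y trans M (first_action pi x) x y *
    Ex (law M (tail_policy pi x) y) (fun w =>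
      g (r + b * partial_reward (tail_policy pi x) b n w)) @[n --> \oo] -->
  \sum_y trans M (first_action pi x) x y *
    Ex (law M (tail_policy pi x) y) (fun w =>
      g (r + b * discounted_reward M (tail_policy pi x) b w)).
  apply: cvg_big => [|y _]; first exact: add_continuous.
  apply: cvgMl_tmp.
  exact: (@Ex_partial_cvg (tail_policy pi x) y _ cg').
rewrite -(cvg_shiftn 1) in c2.
suff E12 n : Ex (law M pi x) (fun w => g (partial_reward pi b (n + 2) w)) =
    \sum_y trans M (first_action pi x) x y *
      Ex (law M (tail_policy pi x) y) (fun w =>
        g (r + b * partial_reward (tail_policy pi x) b (n + 1) w)).
  by move: c1; rewrite (funext E12) => c1; exact: (cvg_unique _ c1 c2).
rewrite addn2 addn1.
rewrite (@Ex_prefix_one_step _ _ n); last first.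
  by move=> w w' ww'; rewrite (@partial_reward_prefix pi b n.+2 w w' ww').
apply: eq_bigr => y _; congr (_ * Ex _ _); apply/funext => w /=.
by rewrite partial_reward_path_cons.
Qed.

End one_step.

(** * Dynamic programming *)

Section dynamic_programming.
Context (R : realType) (E U : pointedFinType) (M : mdp R E U).
Implicit Types (u : E -> U) (pi : markov_policy E U).

(** The functional that J applies to the reward, with respect to a finite
distribution p. *)
Definition certainty_equivalent (g : R) (p V : E -> R) : R :=
  if g != 0 then g^-1 * ln (\sum_y p y * expR (g * V y)) else \sum_y p y * V y.

Lemma mean_expR_gt0 (p V : E -> R) : (forall y, 0 <= p y) -> \sum_y p y = 1 ->
  0 < \sum_y p y * expR (V y).
Proof.
move=> p0 p1; rewrite lt_neqAle sumr_ge0 ?andbT => [|y _]; last first.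
  by rewrite mulr_ge0// expR_ge0.
apply/eqP => /esym/eqP; rewrite psumr_eq0 => [/allP pV|y _]; last first.
  by rewrite mulr_ge0// expR_ge0.
have : \sum_y p y = 0.
  apply: big1 => y _; have := pV y (mem_index_enum y).
  by rewrite mulf_eq0 [_ == 0 in X in _ || X]gt_eqF ?expR_gt0// orbF => /eqP.
by rewrite p1 => /eqP; rewrite oner_eq0.
Qed.

Lemma certainty_equivalent_le g (p V W : E -> R) :
  (forall y, 0 <= p y) -> \sum_y p y = 1 -> (forall y, V y <= W y) ->
  certainty_equivalent g p V <= certainty_equivalent g p W.
Proof.
move=> p0 p1 VW; rewrite /certainty_equivalent; case: ifPn => [g0|_]; last first.
  by apply: ler_sum => y _; rewrite ler_wpM2l.
have gt0 V' := @mean_expR_gt0 p (fun y => g * V' y) p0 p1.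
case: (ltgtP g 0) g0 => // [g_lt0|g_gt0] _.
  rewrite ler_nM2l ?invr_lt0// ler_ln ?posrE//.
  by apply: ler_sum => y _; rewrite ler_wpM2l// ler_expR ler_wnM2l// ltW.
rewrite ler_pM2l ?invr_gt0// ler_ln ?posrE//.
by apply: ler_sum => y _; rewrite ler_wpM2l// ler_expR ler_wpM2l// ltW.
Qed.

Lemma J_Ex g x (pi : policy E U) b : J M g x pi b =
  if g != 0 then
    g^-1 * ln (Ex (law M pi x) (fun w => expR (g * discounted_reward M pi b w)))
  else Ex (law M pi x) (discounted_reward M pi b).
Proof. by rewrite /J !ExE. Qed.

Lemma expR_J g x (pi : policy E U) b : 0 < b < 1 -> g != 0 ->
  expR (g * J M g x pi b) =
  Ex (law M pi x) (fun w => expR (g * discounted_reward M pi b w)).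
Proof.
move=> b01 g0; rewrite J_Ex g0 mulVKf// lnK// posrE; apply: Ex_expR_gt0.
exact/bounded_rvZ/bounded_rv_discounted_reward.
Qed.

(** The risk parameter of the remaining problem is g * b, because
g * (c + b S) = g * c + (g * b) * S. *)
Lemma J_one_step g x (pi : policy E U) b : 0 < b < 1 ->
  J M g x pi b = reward M x (first_action pi x) +
    certainty_equivalent g (trans M (first_action pi x) x)
      (fun y => b * J M (g * b) y (tail_policy pi x) b).
Proof.
move=> b01; rewrite J_Ex /certainty_equivalent.
set r := reward M x _; set p := trans M _ x.
have bD := bounded_rv_discounted_reward M b01 (tail_policy pi x).
have [->|g0] /= := eqVneq g 0.
  have := @Ex_one_step _ _ _ M b b01 pi x id (fun _ => @cvg_id _ _) => /= ->.
  rewrite -/r -/p -[r in RHS]mulr1 -(trans_sum1 M (first_action pi x) x) mulr_sumr.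
  rewrite -big_split/=; apply: eq_bigr => y _.
  rewrite (ExD _ (bounded_rv_cst _ r) (bounded_rvZ b bD)) Ex_cst ExZ// J_Ex mul0r eqxx/= mulrDr.
  by rewrite [p y * r]mulrC.
have cg : continuous (fun s : R => expR (g * s)).
  move=> s; apply: continuous_comp; last exact: continuous_expR.
  by apply: cvgM; [exact: cvg_cst|exact: cvg_id].
have := @Ex_one_step _ _ _ M b b01 pi x _ cg => ->; rewrite -/r -/p.
have gb0 : g * b != 0 by rewrite mulf_neq0// gt_eqF//; case/andP: b01.
have -> : \sum_y p y * Ex (law M (tail_policy pi x) y)
    (fun w => expR (g * (r + b * discounted_reward M (tail_policy pi x) b w))) =
    expR (g * r) * \sum_y p y * expR (g * (b * J M (g * b) y (tail_policy pi x) b)).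
  rewrite mulr_sumr; apply: eq_bigr => y _.
  rewrite [g * (b * _)]mulrA expR_J// mulrCA; congr (_ * _).
  rewrite -ExZ; last by apply: bounded_rv_expR; exact: bounded_rvZ.
  by congr Ex; apply/funext => w; rewrite -expRD; congr expR; ring.
rewrite lnM ?posrE ?expR_gt0//; last first.
  by apply: mean_expR_gt0; [exact: trans_ge0|exact: trans_sum1].
by rewrite expRK mulrDr mulKf.
Qed.

Lemma optimalP b g pi : optimal M b g pi <->
  forall x sigma, J M g x sigma b <= J M g x (markov pi) b.
Proof.
split=> [opt x sigma|opt x].
  rewrite -lee_fin opt; apply: ereal_sup_ubound; by exists sigma.
apply/eqP; rewrite eq_le; apply/andP; split.
  by apply: ereal_sup_ubound; exists (markov pi).
by apply: ub_ereal_sup => _ [sigma _ <-]; rewrite lee_fin.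
Qed.

Lemma first_action_markov pi x : first_action (markov pi) x = pi 0%N x.
Proof. by rewrite /first_action /markov (tnth_nth x). Qed.

Lemma tail_policy_markov pi x :
  tail_policy (markov pi) x = markov (fun n => pi n.+1).
Proof.
apply: functional_extensionality_dep => n; apply/funext => h.
by rewrite /tail_policy /markov !(tnth_nth x).
Qed.

Definition policy_cons (u : E -> U) pi : markov_policy E U :=
  fun n => if n is m.+1 then pi m else u.

(** Any policy is dominated by its first action followed by pi, since pi is at
least as good as what remains of that policy and the certainty equivalent is
increasing; the best first action is then chosen in each state. *)
Lemma optimal_cons b g pi : 0 < b < 1 -> optimal M b (g * b) pi ->
  exists u, optimal M b g (policy_cons u pi).
Proof.
move=> b01 /optimalP opt.
pose F x a := reward M x a + certainty_equivalent g (trans M a x)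
  (fun y => b * J M (g * b) y (markov pi) b).
have /choice[u uF] : forall x, exists a, forall a', F x a' <= F x a.
  move=> x; exists [arg max_(a > point) F x a]%O => a'.
  by case: arg_maxP => //= a _; apply.
exists u; apply/optimalP => x sigma.
rewrite [leRHS]J_one_step// first_action_markov tail_policy_markov/=.
apply: le_trans (uF x (first_action sigma x)); rewrite J_one_step// lerD2l.
apply: certainty_equivalent_le => [||y]; [exact: trans_ge0|exact: trans_sum1|].
by rewrite ler_wpM2l ?opt// ltW//; case/andP: b01.
Qed.

(** Each decision put in front multiplies the risk parameter of the remaining
problem by b. *)
Lemma optimal_eventually b g n u : 0 < b < 1 ->
  optimal M b (g * b ^+ n) (stationary u) ->
  exists2 pi, optimal M b g pi & forall m, (n <= m)%N -> pi m = u.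
Proof.
move=> b01; elim: n g => [|n ih] g.
  by rewrite mulr1 => opt; exists (stationary u).
rewrite exprS mulrA => /ih[pi opt piu].
have [u0 opt0] := optimal_cons b01 opt.
by exists (policy_cons u0 pi) => // -[//|m]; exact: piu.
Qed.

(** The policies (u_0, ..., u_(N - 1), u, u, ...). *)
Definition constant_from N : set (markov_policy E U) :=
  [set pi | forall n, (N <= n)%N -> pi n = pi N].

Lemma finite_constant_from N : finite_set (constant_from N).
Proof.
pose F (f : {ffun 'I_N.+1 -> {ffun E -> U}}) : markov_policy E U :=
  fun n => f (inord (minn n N)).
apply: (@sub_finite_set _ _ (F @` [set: _])); last first.
  by apply: finite_image; exact: finite_finset.
move=> pi piN; exists [ffun i : 'I_N.+1 => [ffun x => pi i x]] => //.
apply/funext => n; apply/funext => x; rewrite /F !ffunE inordK ?ltnS ?geq_minr//.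
by have [//|/ltnW Nn] := leqP n N; rewrite [in RHS]piN.
Qed.

Lemma constant_from_stationary N pi :
  constant_from N pi -> ultimately_stationary pi.
Proof. by move=> piN; exists N, (pi N). Qed.

(** By definition of the two thresholds as an infimum and a supremum, a stationary
policy is optimal for all g strictly between them. *)
Lemma stationary_optimal_near0 eps : (0 < rho_lower M eps)%E ->
  exists2 rho, 0 < rho & forall b g, eps <= b <= 1 - eps -> `|g| < rho ->
    exists u, optimal M b g (stationary u).
Proof.
move=> rho0.
have [rho rho_gt0 rho_le] : exists2 rho : R, 0 < rho & (rho%:E <= rho_lower M eps)%E.
  case: (rho_lower M eps) rho0 => [r|_|//]; first by rewrite lte_fin; exists r.
  by exists 1; rewrite ?leey.
exists rho => // b g beps grho.
have : (rho%:E <= mine (- gamma_minus M b) (gamma_plus M b))%E.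
  apply: (le_trans rho_le); apply: ereal_inf_lbound; exists b => //=.
rewrite le_min => /andP[rhom rhop]; have [g0|g0] := leP 0 g.
  have : (g%:E < gamma_plus M b)%E.
    by apply: lt_le_trans rhop; rewrite lte_fin (le_lt_trans (ler_norm _)).
  move=> /ereal_sup_gt[_ [r [r0 [u uopt]] <-]]; rewrite lte_fin => gr.
  by exists u; apply: uopt; rewrite g0 ltW.
have : (gamma_minus M b < g%:E)%E.
  rewrite -lteN2 -EFinN; apply: lt_le_trans rhom.
  by rewrite lte_fin -(ltr0_norm g0).
move=> /ereal_inf_lt[_ [r [r0 [u uopt]] <-]]; rewrite lte_fin => gr.
by exists u; apply: uopt; rewrite (ltW gr) ltW.
Qed.

Lemma optimal_constant_from eps g0 : 0 < eps -> 0 < g0 ->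
  (0 < rho_lower M eps)%E ->
  exists N, forall b g, rectangle eps g0 (b, g) ->
    exists2 pi, constant_from N pi & optimal M b g pi.
Proof.
move=> eps0 g00 /stationary_optimal_near0[rho rho0 near0].
have [eps1|eps1] := leP 1 eps.
  exists 0%N => b g [/=]; rewrite in_itv/= => /andP[h1 h2]; lra.
have e1 : `|1 - eps| < 1 by rewrite ger0_norm; lra.
(* Some N satisfies g0 * (1 - eps)^N < rho, and b <= 1 - eps. *)
have := @cvg_geometric R g0 _ e1 => /cvgrPdist_lt/(_ _ rho0)[N _ /(_ N (leqnn N))].
rewrite sub0r normrN /geometric/= => Nrho; exists N => b g [/=].
rewrite !in_itv/= => bE gE.
have b01 : 0 < b < 1 by lra.
have [|u uopt] := near0 b (g * b ^+ N) bE.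
  apply: le_lt_trans Nrho; rewrite !normrM ler_pM// ?normrX.
    by rewrite [`|g0|]gtr0_norm// ler_norml.
  apply: lerXn2r; rewrite ?nnegrE//; have /andP[b0 b1] := b01.
  by rewrite gtr0_norm// ger0_norm; lra.
have [pi opt piu] := optimal_eventually b01 uopt.
by exists pi => // n Nn; rewrite !piu.
Qed.

End dynamic_programming.

(** * Joint continuity of the value *)

Section continuity.
Context (R : realType) (E U : pointedFinType) (M : mdp R E U).
Variables (x : E) (pi : policy E U).
Notation D := (discounted_reward M pi).
Notation C := (reward_bound M).

(** The modulus of continuity of the discounted reward in the discount factor, with
C times the difference of two geometric sums as the bound. *)
Definition reward_modulus (b0 b : R) := C * `|(1 - b)^-1 - (1 - b0)^-1|.

Lemma discounted_reward_dist (b0 b : R) w : 0 < b0 < 1 -> 0 < b < 1 ->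
  `|D b w - D b0 w| <= reward_modulus b0 b.
Proof.
move=> b001 b01; rewrite /reward_modulus.
wlog bb : b b0 b01 b001 / b0 <= b.
  move=> h; have [/h|/ltW/h] := leP b0 b; first exact.
  by rewrite distrC [X in _ <= _ * X]distrC; exact.
have n1 (c : R) : 0 < c < 1 -> `|c| < 1 by move=> /andP[c0 c1]; rewrite gtr0_norm.
have geo (c : R) : 0 < c < 1 -> series (geometric 1 c) @ \oo --> (1 - c)^-1.
  by move=> /n1 /(@cvg_geometric_series R 1 c); rewrite mul1r.
have cv : (fun n => C * (series (geometric 1 b) n - series (geometric 1 b0) n))
    @ \oo --> C * `|(1 - b)^-1 - (1 - b0)^-1|.
  rewrite ger0_norm; first by apply: cvgMl_tmp; apply: cvgB; exact: geo.
  have /andP[_ b1] := b01; have /andP[_ b01'] := b001.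
  by rewrite subr_ge0 lef_pV2 ?posrE ?subr_gt0// lerD2l lerN2.
apply: (ler_cvg_to _ cv (f := fun n => `|partial_reward M pi b n w - partial_reward M pi b0 n w|)).
  by apply: cvg_norm; apply: cvgB; exact: partial_reward_cvg.
apply: nearW => n; rewrite /partial_reward /series/= -!sumrB mulr_sumr.
rewrite (le_trans (ler_norm_sum _ _ _))//; apply: ler_sum => i _.
rewrite -mulrBl normrM mulrC !mul1r ler_pM ?reward_boundP// ger0_norm//.
rewrite subr_ge0; apply: lerXn2r; rewrite // ?nnegrE ltW//.
  by case/andP: b001.
by case/andP: b01.
Qed.

Lemma inv_onem_cvg (b0 g0 : R) : 0 < b0 < 1 ->
  (1 - bg.1)^-1 @[bg --> (b0, g0)] --> (1 - b0)^-1.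
Proof.
move=> /andP[_ b01]; apply: cvgV; first by rewrite subr_eq0 gt_eqF.
by apply: cvgB; [exact: cvg_cst|exact: cvg_fst].
Qed.

Lemma reward_modulus_cvg (b0 g0 : R) : 0 < b0 < 1 ->
  reward_modulus b0 bg.1 @[bg --> (b0, g0)] --> 0.
Proof.
move=> b01; rewrite -[X in _ --> X](mulr0 C) -(normr0 R) -(subrr (1 - b0)^-1).
apply: cvgMl_tmp; apply: cvg_norm; apply: cvgB; last exact: cvg_cst.
exact: inv_onem_cvg.
Qed.

Lemma horizon_bound_cvg (b0 g0 : R) : 0 < b0 < 1 ->
  horizon_bound M bg.1 @[bg --> (b0, g0)] --> horizon_bound M b0.
Proof. by move=> b01; apply: cvgMl_tmp; exact: inv_onem_cvg. Qed.

Lemma cvg_of_dist T (F : set_system T) (FF : Filter F) (f Phi : T -> R) (l : R) :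
  (\forall t \near F, `|f t - l| <= Phi t) -> Phi @ F --> 0 -> f @ F --> l.
Proof.
move=> fP /cvgrPdist_lt P0; apply/cvgrPdist_lt => e e0.
near=> t; rewrite distrC (@le_lt_trans _ _ (Phi t))//; first by near: t.
rewrite (le_lt_trans (ler_norm _))// -normrN -[- _]add0r; near: t; exact: P0.
Unshelve. all: by end_near. Qed.

Lemma near01 (b0 g0 : R) : 0 < b0 < 1 ->
  \forall bg \near (b0, g0), 0 < bg.1 < 1.
Proof.
move=> /andP[b0_gt0 b0_lt1].
have cf : bg.1 @[bg --> (b0, g0)] --> b0 by exact: cvg_fst.
have gt0 := cvgr_gt _ cf _ b0_gt0; have lt1 := cvgr_lt _ cf _ b0_lt1.
near=> bg; apply/andP; split; near: bg; [exact: gt0|exact: lt1].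
Unshelve. all: by end_near. Qed.

(** J is here a quotient by gamma of ln E[e^(gamma S)], whose continuity follows from
that of gamma S for the uniform norm. *)
Lemma J_continuous_ne0 (b0 g0 : R) : 0 < b0 < 1 -> g0 != 0 ->
  J M bg.2 x pi bg.1 @[bg --> (b0, g0)] --> J M g0 x pi b0.
Proof.
move=> b001 g00.
pose L (bg : R * R) := ln (Ex (law M pi x) (fun w => expR (bg.2 * D bg.1 w))).
have cL : L bg @[bg --> (b0, g0)] --> L (b0, g0).
  apply: (@cvg_of_dist _ _ _ _ (fun bg : R * R => `|bg.2| * reward_modulus b0 bg.1 +
     `|bg.2 - g0| * horizon_bound M b0)).
    near=> bg; have b01 : 0 < bg.1 < 1 by near: bg; exact: near01.
    apply: ln_Ex_expR_dist => [||w]; [exact/bounded_rvZ/bounded_rv_discounted_reward..|].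
    have -> : bg.2 * D bg.1 w - (b0, g0).2 * D (b0, g0).1 w =
      bg.2 * (D bg.1 w - D b0 w) + (bg.2 - g0) * D b0 w by rewrite /=; ring.
    rewrite (le_trans (ler_normD _ _))// !normrM lerD// ler_wpM2l//.
      exact: discounted_reward_dist.
    exact: discounted_reward_le.
  rewrite [X in _ --> X](_ : _ = `|g0| * 0 + `|g0 - g0| * horizon_bound M b0); last first.
    by rewrite subrr normr0 mul0r mulr0 addr0.
  apply: cvgD; first by apply: cvgM; [apply: cvg_norm; exact: cvg_snd|exact: reward_modulus_cvg].
  apply: cvgMr_tmp; apply: cvg_norm; apply: cvgB; [exact: cvg_snd|exact: cvg_cst].
rewrite J_Ex g00.
have c2 : bg.2 @[bg --> (b0, g0)] --> g0 by exact: cvg_snd.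
have cg : bg.2^-1 @[bg --> (b0, g0)] --> g0^-1 by exact: (cvgV g00 c2).
apply: cvg_trans (cvgM cg cL).
apply: near_eq_cvg; near=> bg; rewrite J_Ex ifT//.
near: bg; exact: (cvgr_neq0 _ c2).
Unshelve. all: by end_near. Qed.

(** The quotient by gamma degenerates: both J_gamma and J_0 are compared with the mean
at the same discount factor. *)
Lemma J_continuous_0 (b0 : R) : 0 < b0 < 1 ->
  J M bg.2 x pi bg.1 @[bg --> (b0, (0 : R))] --> J M 0 x pi b0.
Proof.
move=> b001.
apply: (@cvg_of_dist _ _ _ _ (fun bg : R * R =>
  `|bg.2| * (2 * (2 * horizon_bound M bg.1) ^+ 2) + reward_modulus b0 bg.1)).
  near=> bg; have b01 : 0 < bg.1 < 1 by near: bg; exact: near01.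
  have -> : J M bg.2 x pi bg.1 - J M 0 x pi b0 =
    (J M bg.2 x pi bg.1 - Ex (law M pi x) (D bg.1)) +
    (Ex (law M pi x) (D bg.1) - Ex (law M pi x) (D b0)).
    by rewrite [J M 0 _ _ _]J_Ex eqxx/= addrA subrK.
  rewrite (le_trans (ler_normD _ _))// lerD//; last first.
    rewrite -ExB; [|exact: bounded_rv_discounted_reward..].
    apply: Ex_norm_le => [|w]; first by apply: bounded_rvB; exact: bounded_rv_discounted_reward.
    exact: discounted_reward_dist.
  rewrite J_Ex; case: ifPn => [g0|_]; last first.
    by rewrite subrr normr0 mulr_ge0// mulr_ge0// sqr_ge0.
  apply: cumulant_near0 => //.
  - exact: bounded_rv_discounted_reward.
  - by move=> w; exact: discounted_reward_le.
  - near: bg.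
    have : (fun bg : R * R => `|bg.2| * (2 * horizon_bound M bg.1))
        @ (b0, (0 : R)) --> `|0 : R| * (2 * horizon_bound M b0).
      apply: cvgM; first by apply: cvg_norm; exact: cvg_snd.
      by apply: cvgMl_tmp; exact: horizon_bound_cvg.
    rewrite normr0 mul0r => /cvgr_le; apply; lra.
rewrite [X in _ --> X](_ : _ = `|0 : R| * (2 * (2 * horizon_bound M b0) ^+ 2) + 0); last first.
  by rewrite normr0 mul0r addr0.
apply: cvgD; last exact: reward_modulus_cvg.
apply: cvgM; first by apply: cvg_norm; exact: cvg_snd.
apply: cvgMl_tmp; apply: (@cvg_comp _ _ _ _ (fun r => r ^+ 2)); last exact: exprn_continuous.
by apply: cvgMl_tmp; exact: horizon_bound_cvg.
Unshelve. all: by end_near. Qed.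

Lemma J_continuous (bg : R * R) : 0 < bg.1 < 1 ->
  J M bg'.2 x pi bg'.1 @[bg' --> bg] --> J M bg.2 x pi bg.1.
Proof.
case: bg => b g /= b01; have [->|g0] := eqVneq g 0; first exact: J_continuous_0.
exact: J_continuous_ne0.
Qed.

End continuity.

(** * Moments of the discounted reward *)

Section moments.
Context (R : realType) (E U : pointedFinType) (M : mdp R E U).
Implicit Types (pi sigma : markov_policy E U).

Definition moment pi x k (b : R) :=
  Ex (law M (markov pi) x) (fun w => discounted_reward M (markov pi) b w ^+ k).

(** Binomial expansion of (c + b S)^k after the first transition. *)
Lemma moment_one_step pi x k b : 0 < b < 1 ->
  moment pi x k b = \sum_y trans M (pi 0%N x) x y *
    \sum_(j < k.+1) (reward M x (pi 0%N x) ^+ (k - j) *+ 'C(k, j)) * b ^+ j *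
                    moment (fun n => pi n.+1) y j b.
Proof.
move=> b01; rewrite /moment.
have := @Ex_one_step _ _ _ M b b01 (markov pi) x _ (@exprn_continuous _ k) => ->.
rewrite first_action_markov tail_policy_markov; apply: eq_bigr => y _.
congr (_ * _); set Q := law _ _ _; set D := discounted_reward _ _ _; set r := reward _ _ _.
have bD : bounded_rv D by exact: bounded_rv_discounted_reward.
transitivity (Ex Q (fun w => \sum_(j < k.+1)
    (r ^+ (k - j) *+ 'C(k, j)) * b ^+ j * D w ^+ j)).
  apply: eq_Ex => w; rewrite exprDn; apply: eq_bigr => j _.
  by rewrite exprMn -mulrnAl mulrA.
rewrite Ex_sum => [|j]; last by apply: bounded_rvZ; exact: bounded_rvX.
by apply: eq_bigr => j _; rewrite ExZ//; exact: bounded_rvX.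
Qed.

(** Induction on k, for all the shifted policies at once.  Past the time N the shift
no longer changes the policy, and the one-step equation is a linear system for
the k-th moments; before N it expresses them through those of the next shift. *)
Lemma moment_rational pi x k : ultimately_stationary pi -> rational01 (moment pi x k).
Proof.
case=> N [u piu].
suff: forall n x, rational01 (moment (fun m => pi (n + m)%N) x k) by move=> /(_ 0%N).
elim/ltn_ind: k {x} => k ih.
have tailE n : (fun m => pi (n + m.+1)%N) = (fun m => pi (n.+1 + m)%N).
  by apply/funext => m; rewrite addnS.
(* The right-hand side of the linear system, known by induction. *)
pose low n x b := \sum_y trans M (pi n x) x y *
    \sum_(j < k) (reward M x (pi n x) ^+ (k - j) *+ 'C(k, j)) * b ^+ j *
                    moment (fun m => pi (n.+1 + m)%N) y j b.
have low_rational n x : rational01 (low n x).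
  apply: rational01_sum => y; apply: rational01M; first exact: rational01_cst.
  apply: rational01_sum => j; apply: rational01M; last exact: ih.
  by apply: rational01M; [exact: rational01_cst|exact: rational01_exp].
have step n x b : 0 < b < 1 -> moment (fun m => pi (n + m)%N) x k b =
    b ^+ k * \sum_y trans M (pi n x) x y * moment (fun m => pi (n.+1 + m)%N) y k b +
    low n x b.
  move=> b01; rewrite moment_one_step// addn0 tailE mulr_sumr -big_split/=.
  apply: eq_bigr => y _; rewrite big_ord_recr/= subnn expr0 binn mulr1n mul1r mulrDr addrC.
  by congr (_ + _); rewrite mulrCA.
case: (posnP k) => [->|k0] in ih low low_rational step *.
  move=> n x; apply: rational01_ext (rational01_cst 1) => b _.
  by rewrite -[LHS](Ex_cst (law M (markov (fun m => pi (n + m)%N)) x)); exact: eq_Ex.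
have tail_rational n : (N <= n)%N -> forall x, rational01 (moment (fun m => pi (n + m)%N) x k).
  move=> Nn; have piE : (fun m => pi (n.+1 + m)%N) = (fun m => pi (n + m)%N).
    by apply/funext => m; rewrite !piu ?(leq_trans Nn) ?leq_addr// addSn -addnS leq_addr.
  apply: (resolvent_rational (P := fun x y => trans M (pi n x) x y) _ _ k0 (low_rational n)).
  - by move=> x y; exact: trans_ge0.
  - by move=> x; exact: trans_sum1.
  - by move=> x b b01; rewrite step// piE.
suff back m n : (N <= n + m)%N -> forall x, rational01 (moment (fun m => pi (n + m)%N) x k).
  by move=> n; apply: (back N n); exact: leq_addl.
elim: m n => [|m ihm] n; first by rewrite addn0; exact: tail_rational.
rewrite addnS -addSn => /ihm next x.
apply: (rational01_ext (fun b b01 => esym (step n x b b01))).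
apply: rational01D => //; apply: rational01M; first exact: rational01_exp.
by apply: rational01_sum => y; apply: rational01M; [exact: rational01_cst|exact: next].
Qed.

(** Analytic continuation from a rectangle: first to all the moments at each discount
factor of the rectangle, then to the moments at every discount factor, and from
there to every risk parameter. *)
Lemma J_eq_of_rectangle pi sigma (b1 b2 g1 g2 : R) :
  ultimately_stationary pi -> ultimately_stationary sigma ->
  0 < b1 -> b1 < b2 -> b2 < 1 -> g1 < g2 ->
  (forall b g x, b1 <= b <= b2 -> g1 <= g <= g2 ->
    J M g x (markov pi) b = J M g x (markov sigma) b) ->
  forall b g x, 0 < b < 1 -> J M g x (markov pi) b = J M g x (markov sigma) b.
Proof.
move=> upi usigma b10 b12 b21 g12 JJ b g x b01.
pose mu pi b := tilted_moment (law M (markov pi) x) (discounted_reward M (markov pi) b).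
have bD pi' b' : 0 < b' < 1 -> bounded_rv (discounted_reward M (markov pi') b').
  by move=> b'01; exact: bounded_rv_discounted_reward.
have mu0 pi' b' g' : mu pi' b' 0%N g' = Ex (law M (markov pi') x)
    (fun w => expR (g' * discounted_reward M (markov pi') b' w)).
  by apply: eq_Ex => w; rewrite expr0 mul1r.
have muk pi' b' k : mu pi' b' k 0 = moment pi' x k b'.
  by apply: eq_Ex => w; rewrite mul0r expR0 mulr1.
have sub01 b' : b1 <= b' <= b2 -> 0 < b' < 1 by move=> /andP[? ?]; lra.
have moments_local b' : b1 <= b' <= b2 -> forall k, moment pi x k b' = moment sigma x k b'.
  move=> b'12 k; have b'01 := sub01 _ b'12; rewrite -!muk.
  apply: (tilted_moments_determine (bD _ _ b'01) (bD _ _ b'01) (a := g1)) => k'.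
  apply: (tilted_moments_of_interval (bD _ _ b'01) (bD _ _ b'01) g12); last by rewrite lexx.
  move=> g' /andP[g1g' g'g2]; rewrite -/(mu pi b' 0%N g') -/(mu sigma b' 0%N g') !mu0.
  (* At g' = 0 equality of the values says nothing about the exponential moments,
   but these are all equal to 1. *)
  have [->|g'0] := eqVneq g' 0.
    have one pi' : Ex (law M (markov pi') x)
        (fun w => expR (0 * discounted_reward M (markov pi') b' w)) = 1.
      rewrite -[RHS](Ex_cst (law M (markov pi') x)); apply: eq_Ex => w.
      by rewrite mul0r expR0.
    by rewrite !one.
  by rewrite -!expR_J// JJ// g1g' ltW.
have moments_eq k : mu pi b k 0 = mu sigma b k 0.
  rewrite !muk; move: b b01; apply: (rational01_identity _ _ b12 sub01).
  - exact: moment_rational.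
  - exact: moment_rational.
  - by move=> b' b'12; exact: moments_local.
have all_eq k g' := tilted_moments_determine (bD pi _ b01) (bD sigma _ b01) moments_eq k g'.
rewrite !J_Ex -!mu0 /mu all_eq; case: ifP => // _.
have := all_eq 1%N 0; rewrite -/(mu pi b 1%N 0) -/(mu sigma b 1%N 0) !muk.
exact.
Qed.

End moments.

(** * Optimality regions *)

Section optimality_regions.
Context (R : realType) (E U : pointedFinType) (M : mdp R E U).
Variables (eps gamma0 : R).
Hypotheses (eps_gt0 : 0 < eps).
Notation G := (rectangle eps gamma0).

Lemma rectangleP (bg : R * R) : G bg <->
  (eps <= bg.1 <= 1 - eps) /\ (- gamma0 <= bg.2 <= gamma0).
Proof. by rewrite /rectangle/= /setX/= !in_itv. Qed.

Lemma rectangle_discount (bg : R * R) : G bg -> 0 < bg.1 < 1.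
Proof. by move=> /rectangleP[/andP[b0 b1] _]; have := eps_gt0; lra. Qed.

Lemma closed_rectangle : closed G.
Proof.
have cl (f : R * R -> R) (a b : R) : continuous f -> closed (f @^-1` `[a, b]).
  by move=> /continuous_closedP; apply; exact: itv_closed.
by apply: closedI; apply: cl => bg; [exact: cvg_fst|exact: cvg_snd].
Qed.

Lemma closed_best_in P0 pi : closed (best_in M G P0 pi).
Proof.
move=> p pcl; have Gp : G p.
  apply: closed_rectangle => B /pcl[q [[Gq _] Bq]]; by exists q.
split=> // x sigma P0sigma; rewrite leNgt; apply/negP => lt.
have p01 := rectangle_discount Gp.
have c : J M q.2 x (markov sigma) q.1 - J M q.2 x (markov pi) q.1 @[q --> p] -->
    J M p.2 x (markov sigma) p.1 - J M p.2 x (markov pi) p.1.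
  exact: cvgB (@J_continuous _ _ _ M x (markov sigma) p p01)
               (@J_continuous _ _ _ M x (markov pi) p p01).
have near_gt : \forall q \near p,
    0 < J M q.2 x (markov sigma) q.1 - J M q.2 x (markov pi) q.1.
  by apply: (cvgr_gt _ c); rewrite subr_gt0.
have [q [[_ /(_ x sigma P0sigma) le]]] := pcl _ near_gt.
by rewrite subr_gt0 ltNge le.
Qed.

Lemma best_in_interior P0 (pi : markov_policy E U) (bg : R * R) : G bg ->
  (interior (best_in M G P0 pi : set (subspace G))) bg ->
  \forall q \near bg, G q -> best_in M G P0 pi q.
Proof.
move=> Gbg bg_int.
have : @nbhs_subspace _ G bg (best_in M G P0 pi) by exact: bg_int.
by rewrite -nbhs_subspace_in.
Qed.

End optimality_regions.

Theorem proposition4p8 (R : realType) (E U : pointedFinType) (M : mdp R E U)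
    (eps gamma0 : R) (eps_gt0 : 0 < eps) (eps_lt : eps < 1 / 2)
    (gamma0_gt0 : 0 < gamma0) (rho_gt0 : (0 < rho_lower M eps)%E) :
  let G := rectangle eps gamma0 in
  exists P0 : set (markov_policy E U),
    [/\ finite_set P0,
        (forall pi, P0 pi -> ultimately_stationary pi) &
        (forall beta gamma, G (beta, gamma) ->
          exists2 pi, P0 pi & optimal M beta gamma pi)] /\
    let K := best_in M G P0 in
    [/\ (forall pi, P0 pi -> rel_closed G (K pi)),
        G `<=` \bigcup_(pi in P0) K pi &
        (forall pi sigma, P0 pi -> P0 sigma ->
          ~ value_equivalent M G pi sigma ->
          K pi `&` K sigma `<=` rel_boundary G (K pi) `|` rel_boundary G (K sigma))].
Proof.
move=> G; have [N Nopt] := optimal_constant_from eps_gt0 gamma0_gt0 rho_gt0.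
exists (constant_from N); split.
  split=> [|pi|b g Gbg]; first exact: finite_constant_from.
    exact: constant_from_stationary.
  exact: Nopt.
move=> K; split=> [pi _|bg Gbg|pi sigma Ppi Psigma npisigma bg [Kpi Ksigma]].
- by apply: closed_subspaceW; exact: closed_best_in.
- have [|pi Ppi /optimalP opt] := Nopt bg.1 bg.2; first by case: bg Gbg.
  by exists pi.
apply: contrapT => /not_orP[bpi bsigma]; apply: npisigma.
have Gbg : G bg by case: Kpi.
have intK tau : K tau bg -> ~ rel_boundary G (K tau) bg ->
    \forall q \near bg, G q -> K tau q.
  move=> Ktau ntau; apply: best_in_interior => //; apply: contrapT => nint.
  by apply: ntau; split=> //; exact: subset_closure.
have : \forall q \near bg, G q -> K pi q /\ K sigma q.
  near=> q; have Kpiq : G q -> K pi q by near: q; exact: intK.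
  have Ksq : G q -> K sigma q by near: q; exact: intK.
  by move=> Gq; split; [exact: Kpiq|exact: Ksq].
move=> /nbhs_ballP[e /= e0 eK].
have [/andP[b_ge b_le] /andP[g_ge g_le]] := (rectangleP _ _ _).1 Gbg.
(* A corner of the rectangle may be involved: the ball is cut with the rectangle,
   and what remains still contains a product of nondegenerate intervals. *)
pose b1 := Num.max eps (bg.1 - e / 2); pose b2 := Num.min (1 - eps) (bg.1 + e / 2).
pose g1 := Num.max (- gamma0) (bg.2 - e / 2); pose g2 := Num.min gamma0 (bg.2 + e / 2).
have JJ : forall b g x, b1 <= b <= b2 -> g1 <= g <= g2 ->
    J M g x (markov pi) b = J M g x (markov sigma) b.
  move=> b g x; rewrite !ge_max !le_min.
  move=> /andP[/andP[? ?] /andP[? ?]] /andP[/andP[? ?] /andP[? ?]].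
  have Gq : G (b, g) by apply/rectangleP => /=; split; apply/andP.
  have [|[_ Kp] [_ Ks]] := eK (b, g) _ Gq.
    by split; rewrite /ball/= ltr_norml; apply/andP; split; lra.
  apply: le_anti; rewrite (Kp x sigma Psigma) andbT; exact: (Ks x pi Ppi).
have b12 : b1 < b2 by rewrite gt_max !lt_min; apply/andP; split; apply/andP; split; lra.
have g12 : g1 < g2 by rewrite gt_max !lt_min; apply/andP; split; apply/andP; split; lra.
have b10 : 0 < b1 by rewrite lt_max eps_gt0.
have b21 : b2 < 1 by rewrite gt_min; apply/orP; left; lra.
move=> x q Gq; apply: (J_eq_of_rectangle _ _ b10 b12 b21 g12 JJ).
- exact: constant_from_stationary Ppi.
- exact: constant_from_stationary Psigma.
- exact: rectangle_discount Gq.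
Unshelve. all: by end_near. Qed.
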